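(* Let $r\in\mathbb{R}$ with $|r|\le 1$ and $r\neq 0$, and suppose the alternative hypothesis $H_a$ holds, i.e. the two AR(1) processes $\{X_n\}$ and $\{Y_n\}$ are correlated with coefficient $r$. Let $c_a>0$. Then there is a constant $C_{13}(\alpha,r)$, depending on $\alpha$ and $r$, such that for all $n$ sufficiently large, $$P\left( | \sqrt{n}\, \theta_n | > c_a \,\Big|\, H_a \right) \geq \Phi\left( \frac{1}{1-r^2} \sqrt{\frac{1-\alpha^2}{1 + \alpha^2}} \left( c_a - \sqrt{n}\, r \right) \right) + \Phi\left( \frac{1}{1-r^2} \sqrt{\frac{1-\alpha^2}{1 + \alpha^2}} \left( c_a + \sqrt{n}\, r \right) \right) - 2 C_{13}(\alpha, r) \sqrt{\frac{\ln n}{n}}.$$ In the case $r\neq 0$ the right-hand side tends to $1$ as $n\to\infty$. Consequently, the test of independence with rejection region $|\sqrt n\,\theta_n|>c_a$ has asymptotic power tending to $1$.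
   Context: Let $\alpha\in\mathbb{R}$ with $|\alpha|<1$. Define $X_0=Y_0=0$ and $X_n=\alpha X_{n-1}+\xi_n$, $Y_n=\alpha Y_{n-1}+\eta_n$ for $n\ge 1$, where the increments $\xi_n,\eta_n$ are standard normal. The null hypothesis $H_0$ is that $\{X_n\}$ and $\{Y_n\}$ are independent, meaning that $\xi_1,\xi_2,\dots,\eta_1,\eta_2,\dots$ are independent. The alternative hypothesis $H_a$ is that $\{X_n\}$ and $\{Y_n\}$ are correlated with coefficient $r$, meaning that the pairs $(\xi_n,\eta_n)$, $n\ge1$, are i.i.d. Gaussian random vectors with mean zero and covariance matrix $\begin{pmatrix}1&r\\ r&1\end{pmatrix}$, where $|r|\le 1$ and $r\ne 0$. $P(\,\cdot\,|\,H_a)$ denotes probability under $H_a$. The constant $c_a>0$ is selected according to the given level of the test. Put $Z_{11}^n=\frac1n\sum_{i=1}^n X_i^2-\frac1{n^2}\left(\sum_{i=1}^n X_i\right)^2$, $Z_{22}^n=\frac1n\sum_{i=1}^n Y_i^2-\frac1{n^2}\left(\sum_{i=1}^n Y_i\right)^2$, $Z_{12}^n=\frac1n\sum_{i=1}^n X_iY_i-\frac1{n^2}\left(\sum_{i=1}^n X_i\right)\left(\sum_{i=1}^n Y_i\right)$, and $\theta_n=Z_{12}^n/\sqrt{Z_{11}^nZ_{22}^n}$ (the empirical correlation). $\Phi$ denotes the upper tail of the standard normal distribution: $\Phi(x)=\int_x^\infty\frac{1}{\sqrt{2\pi}}e^{-y^2/2}\,dy$. *)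

(* Defs.v *)
From HB Require Import structures.
From mathcomp Require Import all_boot all_order all_algebra.
From mathcomp Require Import all_classical all_reals all_analysis.

Set Implicit Arguments.
Unset Strict Implicit.
Unset Printing Implicit Defensive.

Import Order.TTheory GRing.Theory Num.Theory.
Import numFieldNormedType.Exports.

Local Open Scope classical_set_scope.
Local Open Scope ring_scope.

Definition mutually_independent (d d' : measure_display)
    (T : measurableType d) (T' : measurableType d') (R : realType)
    (P : probability T R) (I : eqType) (W : I -> T -> T') : Prop :=
  forall (J : seq I) (A : I -> set T'), uniq J ->
    (forall j, measurable (A j)) ->
    P (\bigcap_(j in [set` J]) (W j @^-1` A j)) =
    (\prod_(j <- J) P (W j @^-1` A j))%E.

Definition identically_distributed (d d' : measure_display)
    (T : measurableType d) (T' : measurableType d') (R : realType)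
    (P : probability T R) (I : Type) (W : I -> T -> T') : Prop :=
  forall (i j : I) (A : set T'), measurable A ->
    P (W i @^-1` A) = P (W j @^-1` A).

(* The normal law N(m, s^2), where s = 0 gives the point mass at m
   (normal_prob m 0 is a dummy uniform law). *)
Definition gaussian_law (R : realType) (m s : R) (A : set R) : \bar R :=
  if s == 0 then dirac m A else normal_prob m s A.

(* (U, V) is a Gaussian vector: every linear combination of its coordinates is
   a possibly degenerate Gaussian variable. No density is assumed, so perfectly
   correlated coordinates are allowed. *)
Definition gaussian_vector2 (d : measure_display) (T : measurableType d)
    (R : realType) (P : probability T R) (U V : {RV P >-> R}) : Prop :=
  forall a b : R, exists m s : R, forall A : set R, measurable A ->
    P [set w | A (a * U w + b * V w)] = gaussian_law m s A.

Definition centered_gaussian_pair (d : measure_display) (T : measurableType d)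
    (R : realType) (P : probability T R) (r : R) (U V : {RV P >-> R}) : Prop :=
  [/\ gaussian_vector2 U V,
      ('E_P[U] = 0 /\ 'E_P[V] = 0)%E,
      covariance P U U = 1%E /\ covariance P V V = 1%E &
      covariance P U V = r%:E].

(* Only the increments of index n >= 1 are constrained; xi 0 and eta 0 are
   never used. *)
Definition H_a (d : measure_display) (T : measurableType d) (R : realType)
    (P : probability T R) (r : R) (xi eta : nat -> {RV P >-> R}) : Prop :=
  let W := fun (n : nat) (w : T) => (xi n.+1 w, eta n.+1 w) in
  [/\ mutually_independent P W, identically_distributed P W &
      forall n : nat, (1 <= n)%N -> centered_gaussian_pair r (xi n) (eta n)].

Fixpoint AR1 (R : realType) (alpha : R) (e : nat -> R) (n : nat) : R :=
  if n is m.+1 then alpha * AR1 alpha e m + e m.+1 else 0.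

Definition emp_cov (R : realType) (x y : nat -> R) (n : nat) : R :=
  n%:R^-1 * (\sum_(1 <= i < n.+1) x i * y i)
  - (n%:R ^+ 2)^-1 * ((\sum_(1 <= i < n.+1) x i) * (\sum_(1 <= i < n.+1) y i)).

Definition emp_corr (R : realType) (x y : nat -> R) (n : nat) : R :=
  emp_cov x y n / Num.sqrt (emp_cov x x n * emp_cov y y n).

Definition theta (d : measure_display) (T : measurableType d) (R : realType)
    (P : probability T R) (alpha : R) (xi eta : nat -> {RV P >-> R})
    (n : nat) (w : T) : R :=
  emp_corr (AR1 alpha (fun i => xi i w)) (AR1 alpha (fun i => eta i w)) n.

Definition rejection_region (d : measure_display) (T : measurableType d)
    (R : realType) (P : probability T R) (alpha c : R)
    (xi eta : nat -> {RV P >-> R}) (n : nat) : set T :=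
  [set w | c < `|Num.sqrt n%:R * theta alpha xi eta n w|].

(* Upper tail, not the distribution function. *)
Definition Phi (R : realType) (x : R) : R :=
  \int[lebesgue_measure]_(y in `[x, +oo[)
    ((Num.sqrt (2 * pi))^-1 * expR (- (y ^+ 2) / 2)).

(* For |r| = 1 the factor 1 / (1 - r^2) is 0 here and the two Phi terms add up
   to 1/2 + 1/2. Reading that factor as +oo they are, once sqrt n > c, 1 and 0
   in some order, so the value is the same. *)
Definition power_bound (R : realType) (alpha r c C : R) (n : nat) : R :=
  let k := 1 / (1 - r ^+ 2)
           * Num.sqrt ((1 - alpha ^+ 2) / (1 + alpha ^+ 2)) in
  Phi (k * (c - Num.sqrt n%:R * r)) + Phi (k * (c + Num.sqrt n%:R * r))
  - 2 * C * Num.sqrt (ln n%:R / n%:R).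

(* Main.v *)
Require Import Defs.
From HB Require Import structures.
From mathcomp Require Import all_boot all_order all_algebra.
From mathcomp Require Import all_classical all_reals all_analysis.
From mathcomp Require Import measurable_realfun simple_functions ring lra.

(** Under the alternative, independence is rejected with probability
1 - O(1 / sqrt n), and the bound to be reached is at most 1 minus a multiple of
sqrt (ln n / n). The factor sqrt (ln n) between the two error terms absorbs every
constant, so the second moment method suffices and C13 can be any positive
number; it is taken to be 1.

The bound. The Gaussian tail satisfies Phi (- x) = 1 - Phi x ([PhiN]) and is
decreasing. With k the normalising factor, s = sqrt n * r and c > 0, the two
terms Phi (k (c - s)) and Phi (k (c + s)) therefore add up to at most 1
([power_bound_le]); their sum tends to 1 because |s| tends to infinity, or
because k = 0 when |r| = 1 ([cvg_power_bound]).

The test. Let u, v be two (possibly equal) sequences of innovations whose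
products have mean rho, X and Y their autoregressive processes. Expanding
X_(i+1) Y_(i+1) gives
  (1 - alpha^2) * sum_(i <= n) X_i Y_i + alpha^2 X_n Y_n - n rho = S_n,
where the increments of S are orthogonal to the past ([ar_sum_mul_id]); hence
E S_n^2 = O(n), and (1 - alpha^2) * emp_cov X Y n differs from rho by O(1 / sqrt n)
in mean ([mean_abs_emp_cov]). Used for (xi, eta), (xi, xi) and (eta, eta), where
rho is r, 1 and 1, this and the Markov inequality show that, outside an event of
probability O(1 / sqrt n), the empirical correlation is at least |r| / 3 in
absolute value ([emp_corr_lower]), so that sqrt n times it exceeds any fixed
threshold once n is large ([rejection_probability_lower]).

All constants must be uniform in the probability space. This is where normality
enters: it gives a universal bound on the fourth moment of the innovations
([gaussian_fourth_moment_bound]). Orthogonality to the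
past, [past_orthogonal], follows from mutual independence by a pi-lambda argument
and the Fubini theorem. *)

Set Implicit Arguments.
Unset Strict Implicit.
Unset Printing Implicit Defensive.

Import Order.TTheory GRing.Theory Num.Theory.
Import numFieldNormedType.Exports.
Import HBNNSimple.

Local Open Scope classical_set_scope.
Local Open Scope ring_scope.

(** * Elementary inequalities *)

Lemma normM_le_sqD (R : realFieldType) (s t : R) : `|s * t| <= s ^+ 2 + t ^+ 2.
Proof.
rewrite ler_norml; have := sqr_ge0 (s - t); have := sqr_ge0 (s + t).
by move=> *; apply/andP; split; nra.
Qed.

Lemma sqM_le_fourthD (R : realFieldType) (s t : R) :
  (s * t) ^+ 2 <= s ^+ 4 + t ^+ 4.
Proof.
rewrite (exprM s 2 2) (exprM t 2 2).
by have := sqr_ge0 (s ^+ 2 - t ^+ 2); have := sqr_ge0 (s * t); nra.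
Qed.

Lemma sq_le_fourth1 (R : realFieldType) (s : R) : s ^+ 2 <= 1 + s ^+ 4.
Proof. by rewrite (exprM s 2 2); have := sqr_ge0 (s ^+ 2 - 1); nra. Qed.

Lemma convex_sq (R : realFieldType) (alpha b x y : R) :
  `|alpha| + b = 1 -> 0 <= b ->
  (alpha * x + b * y) ^+ 2 <= `|alpha| * x ^+ 2 + b * y ^+ 2.
Proof.
move=> ab b0; have [h1 h2] : 0 <= `|alpha| + alpha /\ 0 <= `|alpha| - alpha.
  by split; [rewrite -[X in _ + X]opprK subr_ge0 -normrN ler_norm|rewrite subr_ge0 ler_norm].
have a2 : alpha ^+ 2 = `|alpha| ^+ 2 by rewrite real_normK ?num_real.
rewrite -subr_ge0; have -> : `|alpha| * x ^+ 2 + b * y ^+ 2 - (alpha * x + b * y) ^+ 2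
   = b * ((`|alpha| + alpha) / 2 * (x - y) ^+ 2 + (`|alpha| - alpha) / 2 * (x + y) ^+ 2).
  have -> : (alpha * x + b * y) ^+ 2 = alpha ^+ 2 * x ^+ 2 + 2 * alpha * b * x * y + b ^+ 2 * y ^+ 2 by ring.
  by rewrite a2 (_ : `|alpha| = 1 - b); [field|rewrite -ab addrK].
by rewrite mulr_ge0// addr_ge0// mulr_ge0 ?sqr_ge0// divr_ge0.
Qed.

(** Convexity of the fourth power: alpha * x + e is a convex combination of
+- x and e / (1 - |alpha|). As the coefficient of x^4 is less than 1, iterating
this inequality bounds the fourth moments of the process uniformly in time. *)
Lemma convex_fourth (R : realFieldType) (alpha x e : R) : `|alpha| < 1 ->
  (alpha * x + e) ^+ 4
  <= `|alpha| * x ^+ 4 + ((1 - `|alpha|) ^+ 3)^-1 * e ^+ 4.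
Proof.
move=> a1; set b := 1 - `|alpha|.
have b0 : 0 < b by rewrite subr_gt0.
have ab : `|alpha| + b = 1 by rewrite addrC subrK.
have nab : `| `|alpha| | + b = 1 by rewrite normr_id.
(* e is the share b of the point y = e / b *)
have -> : e = b * (e / b) by rewrite mulrC divfK ?gt_eqF.
set y := e / b.
have -> : (b ^+ 3)^-1 * (b * y) ^+ 4 = b * y ^+ 4 by field; rewrite gt_eqF.
rewrite !(exprM _ 2 2).
apply: le_trans (_ : (`|alpha| * x ^+ 2 + b * y ^+ 2) ^+ 2 <= _).
  rewrite ler_sqr ?nnegrE ?sqr_ge0 ?convex_sq ?(ltW b0)//.
  by rewrite addr_ge0// mulr_ge0 ?sqr_ge0// ltW.
by have := convex_sq (x ^+ 2) (y ^+ 2) nab (ltW b0); rewrite normr_id.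
Qed.

(** * First absolute moments *)

(** A single predicate carries measurability, integrability and a quantitative
bound; it is stable under sums, scaling and domination, so that a moment
estimate reduces to one pointwise inequality. *)
Definition mean_abs_le d (T : measurableType d) (R : realType)
    (P : probability T R) (f : T -> R) (K : R) : Prop :=
  measurable_fun setT f /\ (\int[P]_w `|f w|%:E <= K%:E)%E.

Section mean_abs.
Context d (T : measurableType d) (R : realType) (P : probability T R).
Implicit Types (f g : T -> R) (a b c e K : R).
Local Notation L1 := (mean_abs_le P).

Lemma mean_abs_leW f a b : a <= b -> L1 f a -> L1 f b.
Proof. by move=> ab [mf fa]; split=> //; apply: le_trans fa _; rewrite lee_fin. Qed.

Lemma mean_abs_le_dominated f g K : measurable_fun setT f ->
  (forall w, `|f w| <= g w) -> L1 g K -> L1 f K.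
Proof.
move=> mf fg [mg gK]; split=> //; apply: le_trans gK.
apply: ge0_le_integral => //.
- by apply/measurable_EFinP; exact: measurableT_comp.
- by apply/measurable_EFinP; exact: measurableT_comp.
- by move=> w _; rewrite lee_fin (le_trans (fg w))// ler_norm.
Qed.

Lemma mean_abs_leD f g a b : L1 f a -> L1 g b -> L1 (fun w => f w + g w) (a + b).
Proof.
move=> [mf fa] [mg gb]; split; first exact: measurable_funD.
apply: (@le_trans _ _ (\int[P]_w (`|f w|%:E + `|g w|%:E))%E).
  apply: ge0_le_integral => //.
  - by apply/measurable_EFinP; apply: measurableT_comp => //; exact: measurable_funD.
  - by apply: emeasurable_funD; apply/measurable_EFinP; exact: measurableT_comp.
  - by move=> w _; rewrite -EFinD lee_fin ler_normD.
rewrite ge0_integralD//; [rewrite EFinD; exact: leeD| |];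
  by apply/measurable_EFinP; exact: measurableT_comp.
Qed.

Lemma mean_abs_leZ f a c : L1 f a -> L1 (fun w => c * f w) (`|c| * a).
Proof.
move=> [mf fa]; split; first exact: measurable_funM.
under eq_integral do rewrite normrM EFinM.
rewrite ge0_integralZl//; last by apply/measurable_EFinP; exact: measurableT_comp.
by rewrite EFinM lee_wpmul2l// lee_fin.
Qed.

Lemma mean_abs_le_cst c : L1 (cst c) `|c|.
Proof.
split; [by []|]; rewrite -[leRHS]mule1 -(@probability_setT _ _ _ P) -integral_cst//.
Qed.

Lemma mean_abs_le_ge0 f a : measurable_fun setT f -> (forall w, 0 <= f w) ->
  (\int[P]_w (f w)%:E <= a%:E)%E -> L1 f a.
Proof.
move=> mf f0 fa; split=> //; apply: le_trans fa.
by rewrite le_eqVlt; apply/orP; left; apply/eqP/eq_integral => w _; rewrite ger0_norm.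
Qed.

Lemma mean_abs_le_norm f a : L1 f a -> L1 (fun w => `|f w|) a.
Proof.
move=> [mf fa]; split; first exact: measurableT_comp.
by under eq_integral do rewrite normr_id.
Qed.

Lemma integral_le_mean_abs f a : (forall w, 0 <= f w) -> L1 f a ->
  (\int[P]_w (f w)%:E <= a%:E)%E.
Proof.
move=> f0 [_]; apply: le_trans; rewrite le_eqVlt; apply/orP; left; apply/eqP.
by apply: eq_integral => w _; rewrite ger0_norm.
Qed.

Lemma mean_abs_le_bound_ge0 f a : L1 f a -> 0 <= a.
Proof.
by move=> [_ fa]; rewrite -lee_fin; apply: le_trans fa; exact: integral_ge0.
Qed.

Lemma mean_abs_le_integrable f a : L1 f a -> P.-integrable setT (EFin \o f).
Proof.
move=> [mf fa]; apply/integrableP; split; first exact/measurable_EFinP.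
by apply: le_lt_trans fa _; rewrite ltry.
Qed.

Lemma mean_abs_le_Markov f a e : 0 < e -> L1 f a ->
  (P [set w | (e <= `|f w|)%R] <= (a / e)%:E)%E.
Proof.
move=> e0 [mf fa].
have mA : measurable [set w | e <= `|f w|].
  rewrite -[X in measurable X]setTI; apply: measurable_fun_ler => //.
  exact: measurableT_comp.
rewrite EFinM lee_pdivlMr// muleC; apply: le_trans fa.
have -> : P [set w | (e <= `|f w|)%R]
    = (\int[P]_w (\1_[set w | (e <= `|f w|)%R] w)%:E)%E.
  by rewrite integral_indic// setIT.
rewrite -ge0_integralZl//; last 2 first.
- exact/measurable_EFinP/measurable_indic.
- by rewrite lee_fin ltW.
apply: ge0_le_integral => //.
- by move=> w _; rewrite mule_ge0// lee_fin ltW.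
- apply/measurable_EFinP; exact: measurable_funM.
- by apply/measurable_EFinP; exact: measurableT_comp.
- move=> w _; rewrite -EFinM lee_fin indicE.
  by case: (boolP (w \in _)) => [|_]; rewrite ?inE ?mulr1 ?mulr0.
Qed.

End mean_abs.

(** * Fourth moments of standardised Gaussian variables *)

Lemma ge0_integral_density d (T : measurableType d) (R : realType)
    (mu nu : {measure set T -> \bar R}) (h : T -> R) (f : T -> \bar R) :
  measurable_fun setT h -> (forall x, 0 <= h x) ->
  (forall A, measurable A -> nu A = (\int[mu]_(x in A) (h x)%:E)%E) ->
  measurable_fun setT f -> (forall x, (0 <= f x)%E) ->
  (\int[nu]_x f x = \int[mu]_x (f x * (h x)%:E))%E.
Proof.
move=> mh h0 nuE mf f0.
have nnsfunE (g : {nnsfun T >-> R}) :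
    (\int[nu]_x (g x)%:E = \int[mu]_x ((g x)%:E * (h x)%:E))%E.
  under [LHS]eq_integral do rewrite fimfunE -fsumEFin//.
  rewrite [LHS]ge0_integral_fsum//; last 2 first.
  - by move=> r; exact/measurable_EFinP/measurableT_comp.
  - by move=> n x _; rewrite EFinM nnfun_muleindic_ge0.
  under [RHS]eq_integral.
    move=> x _; rewrite fimfunE -fsumEFin// muleC ge0_mule_fsumr; last first.
      by move=> r; rewrite EFinM nnfun_muleindic_ge0.
    over.
  rewrite [RHS]ge0_integral_fsum//; last 2 first.
  - move=> r; apply/emeasurable_funM; first exact/measurable_EFinP.
    by apply/measurable_EFinP; apply/measurableT_comp.
  - by move=> n x _; rewrite mule_ge0 ?lee_fin// -lee_fin EFinM nnfun_muleindic_ge0.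
  apply: eq_fsbigr => r _.
  rewrite integralZl_indic_nnsfun//= integral_indic// setIT nuE//.
  have [r0|r0] := leP 0 r.
    rewrite -ge0_integralZl//; last 2 first.
    - exact/measurable_EFinP/measurable_funTS.
    - by move=> x _; rewrite lee_fin.
    rewrite integral_mkcond; apply: eq_integral => x _.
    rewrite patchE indicE; case: (x \in _); rewrite ?mulr1 ?mulr0 ?mule0//.
    by rewrite muleC.
  rewrite preimage_nnfun0// integral_set0 mule0.
  by apply/esym/integral0_eq => x _; rewrite indic0 mulr0 mule0.
pose f_ := nnsfun_approx measurableT mf.
transitivity (lim (\int[nu]_x (f_ n x)%:E @[n --> \oo])%E).
  rewrite -monotone_convergence//=.
  - apply: eq_integral => ? /[!inE] xD; apply/esym/cvg_lim => //=.
    exact: cvg_nnsfun_approx.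
  - by move=> n; exact/measurable_EFinP/measurable_funTS.
  - by move=> n ? _; rewrite lee_fin.
  - by move=> ? _ ? ? mn; rewrite lee_fin; exact/lefP/nd_nnsfun_approx.
rewrite (_ : (fun n => _) = (fun n => \int[mu]_x ((f_ n x)%:E * (h x)%:E))%E); last first.
  by apply/funext => n; exact: nnsfunE.
rewrite -monotone_convergence//=.
- apply: eq_integral => x _; apply/cvg_lim => //=.
  apply: cvgeZr => //; exact: cvg_nnsfun_approx.
- move=> n; apply: emeasurable_funM; exact/measurable_EFinP/measurable_funTS.
- by move=> n x _; rewrite mule_ge0 ?lee_fin.
- move=> x _ m n mn; rewrite lee_wpmul2r ?lee_fin//; exact/lefP/nd_nnsfun_approx.
Qed.

(** With t = (x - m)^2 / (4 s^2), the density is proportional to e^(-t) e^(-t)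
and t^2 e^(-t) <= 2; what remains is proportional to the density of the normal
law with standard deviation sqrt 2 * s. This bounds the central fourth moment by
the total mass 1 of another normal law, without computing any Gaussian
integral. *)
Lemma le_normal_pdf_fourth (R : realType) (m s x : R) : s != 0 ->
  (x - m) ^+ 4 * normal_pdf m s x
  <= 64 * s ^+ 4 * normal_pdf m (Num.sqrt 2 * s) x.
Proof.
move=> s0.
have q0 : 0 < Num.sqrt 2 :> R by rewrite sqrtr_gt0.
have q2 : Num.sqrt 2 ^+ 2 = 2 :> R by rewrite sqr_sqrtr.
have q2s : Num.sqrt 2 <= 2 :> R by nra.
have qs0 : Num.sqrt 2 * s != 0 by apply: mulf_neq0 => //; rewrite gt_eqF.
rewrite !normal_pdfE//.
have pE : normal_peak s = Num.sqrt 2 * normal_peak (Num.sqrt 2 * s).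
  rewrite /normal_peak exprMn q2.
  rewrite (_ : 2 * s ^+ 2 * pi *+ 2 = 2 * (s ^+ 2 * pi *+ 2)); last by ring.
  by rewrite (@sqrtrM _ 2)// invfM mulrA divff ?mul1r ?gt_eqF.
pose t := (x - m) ^+ 2 / (4 * s ^+ 2).
have t0 : 0 <= t by rewrite divr_ge0 ?sqr_ge0// mulr_ge0 ?sqr_ge0.
have tE : (x - m) ^+ 2 = 4 * s ^+ 2 * t.
  by rewrite /t mulrC divfK// mulf_neq0// sqrf_eq0.
have e1 : normal_fun m s x = expR (- t) * expR (- t).
  rewrite /normal_fun -expRD; congr expR; rewrite tE; field; exact: s0.
have e2 : normal_fun m (Num.sqrt 2 * s) x = expR (- t).
  by rewrite /normal_fun exprMn q2; congr expR; rewrite tE; field; exact: s0.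
rewrite e1 e2 pE.
have tt : t ^+ 2 * expR (- t) <= 2.
  have := @expR_ge1Dxn R t 1 t0.
  rewrite (_ : (1.+1)`! = 2%N)// => h.
  rewrite expRN ler_pdivrMr ?expR_gt0//; nra.
set p := normal_peak _.
have p0 : 0 <= p by exact: normal_peak_ge0.
have e0 : 0 <= expR (- t) by exact: expR_ge0.
have -> : (x - m) ^+ 4 * (Num.sqrt 2 * p * (expR (- t) * expR (- t)))
   = (16 * s ^+ 4 * Num.sqrt 2) * (t ^+ 2 * expR (- t)) * (p * expR (- t)).
  rewrite (_ : (x - m) ^+ 4 = ((x - m) ^+ 2) ^+ 2); last by rewrite -exprM.
  by rewrite tE; ring.
apply: ler_wpM2r; first by rewrite mulr_ge0.
have s4 : 0 <= s ^+ 4 by rewrite exprn_even_ge0.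
have : Num.sqrt 2 * (t ^+ 2 * expR (- t)) <= 2 * 2.
  apply: ler_pM => //.
  by rewrite mulr_ge0// sqr_ge0.
by move=> h; have := ler_wpM2l s4 h; lra.
Qed.

Lemma normal_central_fourth_moment (R : realType) (m s : R) : s != 0 ->
  (\int[normal_prob m s]_x ((x - m) ^+ 4)%:E <= (64 * s ^+ 4)%:E)%E.
Proof.
move=> s0.
have mp : measurable_fun [set: R] (fun x => (x - m) ^+ 4).
  by apply: measurable_funX; apply: measurable_funB.
rewrite (@ge0_integral_density _ _ _ lebesgue_measure _ (normal_pdf m s))//; last 4 first.
- exact: measurable_normal_pdf.
- by move=> x; exact: normal_pdf_ge0.
- exact/measurable_EFinP.
- by move=> x; rewrite lee_fin exprn_even_ge0.
apply: (@le_trans _ _ (\int[lebesgue_measure]_x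
    ((64 * s ^+ 4)%:E * (normal_pdf m (Num.sqrt 2 * s) x)%:E))%E).
  apply: ge0_le_integral => //.
  - by move=> x _; rewrite mule_ge0// lee_fin ?exprn_even_ge0 ?normal_pdf_ge0.
  - apply: emeasurable_funM; apply/measurable_EFinP => //.
    exact: measurable_normal_pdf.
  - apply: emeasurable_funM; apply/measurable_EFinP => //.
    exact: measurable_normal_pdf.
  - by move=> x _; rewrite -!EFinM lee_fin le_normal_pdf_fourth.
rewrite ge0_integralZl//; last 3 first.
- by apply/measurable_EFinP; exact: measurable_normal_pdf.
- by move=> x _; rewrite lee_fin normal_pdf_ge0.
- by rewrite lee_fin mulr_ge0// exprn_even_ge0.
by rewrite integral_normal_pdf mule1.
Qed.

Lemma normal_prob_small_ball (R : realType) (m s : R) : s != 0 ->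
  (normal_prob m s (`](-2 : R)%R, 2%R[%classic) <= (4 * normal_peak s)%:E)%E.
Proof.
move=> s0; rewrite /normal_prob.
apply: (@le_trans _ _ (\int[lebesgue_measure]_(x in `](-2)%R, 2%R[%classic) (cst (normal_peak s)%:E x))%E).
  apply: ge0_le_integral => //.
  - by move=> x _; rewrite lee_fin normal_pdf_ge0.
  - by apply/measurable_EFinP/measurable_funTS; exact: measurable_normal_pdf.
  - by move=> x _; rewrite lee_fin normal_pdf_ub.
rewrite integral_cst//= lebesgue_measure_itv/= lte_fin ifT; last by lra.
by rewrite -EFinB -EFinM lee_fin; lra.
Qed.

Lemma integral_sq_centered d (T : measurableType d) (R : realType)
    (P : probability T R) (U V : {RV P >-> R}) (c : \bar R) :
  ('E_P[U] = 0)%E -> ('E_P[V] = 0)%E -> covariance P U V = c ->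
  (\int[P]_w (U w * V w)%:E)%E = c.
Proof.
move=> U0 V0; rewrite unlock U0 V0 /= unlock => <-.
by apply: eq_integral => w _ /=; rewrite !fctE/= !subr0.
Qed.

(** The law of U is only known to be some N(m, s^2), so m and s have to be
controlled first. By Chebyshev |U| < 2 has probability at least 3/4, while the
density is at most a multiple of 1 / |s|: hence s is bounded. Then U - m has a
bounded fourth moment, and m itself is bounded since U has second moment 1. *)
Lemma gaussian_fourth_moment_bound (R : realType) :
  exists2 K : R, 0 <= K &
    forall d (T : measurableType d) (P : probability T R) (U : {RV P >-> R}),
    (exists m s, forall A, measurable A -> P (U @^-1` A) = gaussian_law m s A) ->
    ('E_P[U] = 0)%E -> covariance P U U = 1%E ->
    (\int[P]_w ((U w) ^+ 4)%:E <= K%:E)%E.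
Proof.
pose B : R := 64 * 225; pose K : R := 8 * ((3 + B) ^+ 2 + B).
have B0 : 0 <= B by rewrite mulr_ge0.
have K0 : 1 <= K by rewrite /K; nra.
exists K; first lra.
move=> d T P U [m [s lawU]] EU VU.
have mU : measurable_fun setT U by [].
have U2 : (\int[P]_w ((U w) ^+ 2)%:E)%E = 1%E by exact: integral_sq_centered VU.
have transfer (mu : {measure set (measurableTypeR R) -> \bar R}) (f : R -> R) :
    (forall A, measurable A -> P (U @^-1` A) = mu A) ->
    measurable_fun setT f -> (forall x, 0 <= f x) ->
    (\int[P]_w (f (U w))%:E = \int[mu]_x (f x)%:E)%E.
  move=> PE mf f0.
  have mU' : measurable_fun setT (U : T -> measurableTypeR R) by [].
  have := @ge0_integral_pushforward _ _ _ _ _ _ mU' P setT (fun x => (f x)%:E) measurableT.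
  rewrite preimage_setT => <-; last 2 first.
  - exact/measurable_EFinP.
  - by move=> x _; rewrite lee_fin.
  by apply: eq_measure_integral => A mA _; exact: PE.
(* the degenerate law, a point mass at m with m^2 = 1 *)
have [s0|s0] := eqVneq s 0.
  have PE A : measurable A -> P (U @^-1` A) = dirac m A.
    by move=> mA; rewrite lawU// /gaussian_law s0 eqxx.
  have m2 : m ^+ 2 = 1.
    apply: EFin_inj; rewrite -U2.
    rewrite (transfer (@dirac _ (measurableTypeR R) m R) (fun x => x ^+ 2) PE)//;
      last by move=> x; exact: sqr_ge0.
    by rewrite integral_dirac//= ?diracT ?mul1e//; exact/measurable_EFinP.
  rewrite (transfer (@dirac _ (measurableTypeR R) m R) (fun x => x ^+ 4) PE)//;
    last by move=> x; rewrite exprn_even_ge0.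
  rewrite integral_dirac//= ?diracT ?mul1e//; last exact/measurable_EFinP.
  by rewrite lee_fin (exprM m 2 2) m2 expr1n.
have PE A : measurable A -> P (U @^-1` A) = normal_prob m s A.
  by move=> mA; rewrite lawU// /gaussian_law (negbTE s0).
have s2B : s ^+ 2 <= 15.
  have cheb : (P [set w | (2 <= `|U w|)%R] <= (4^-1)%:E)%E.
    have := @chebyshev _ _ _ P U 2 (ltr0Sn R 1).
    rewrite EU /= /variance VU mule1.
    rewrite (_ : [set x | 2 <= `|U x - 0|] = [set w | 2 <= `|U w|]); last first.
      by apply/seteqP; split => w /=; rewrite subr0.
    by rewrite (_ : 2 ^- 2 = 4^-1 :> R)// -exprVn; lra.
  have m2U : measurable [set w | 2 <= `|U w|].
    rewrite -[X in measurable X]setTI; apply: measurable_fun_ler => //.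
    exact: measurableT_comp.
  have ball : U @^-1` `](-2)%R, 2%R[%classic = ~` [set w | 2 <= `|U w|].
    apply/seteqP; split => w /=; rewrite in_itv/= -ltr_norml ltNge.
      by move/negP.
    by move=> h; apply/negP.
  have := normal_prob_small_ball m s0.
  rewrite -PE; last exact: measurable_itv.
  rewrite ball probability_setC//.
  have [p pE] : exists p : R, P [set w | 2 <= `|U w|] = p%:E.
    by exists (fine (P [set w | 2 <= `|U w|])); rewrite fineK// fin_num_measure.
  move: cheb; rewrite pE -EFinB !lee_fin => p4 pk.
  have q0 : 0 < s ^+ 2 * pi *+ 2.
    by rewrite mulrn_wgt0// mulr_gt0 ?pi_gt0// exprn_even_gt0/=.
  have r0 : 0 < Num.sqrt (s ^+ 2 * pi *+ 2) by rewrite sqrtr_gt0.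
  have rr : Num.sqrt (s ^+ 2 * pi *+ 2) ^+ 2 = s ^+ 2 * pi *+ 2 by rewrite sqr_sqrtr// ltW.
  have kE : normal_peak s * Num.sqrt (s ^+ 2 * pi *+ 2) = 1.
    by rewrite /normal_peak mulVf// gt_eqF.
  have r6 : Num.sqrt (s ^+ 2 * pi *+ 2) <= 16 / 3.
    have : 3 / 16 * Num.sqrt (s ^+ 2 * pi *+ 2) <= 1.
      by rewrite -[leRHS]kE; apply: ler_wpM2r; [exact: ltW|lra].
    by lra.
  have r36 : Num.sqrt (s ^+ 2 * pi *+ 2) ^+ 2 <= (16 / 3) ^+ 2.
    by rewrite ler_sqr// nnegrE; [exact: ltW|lra].
  have : s ^+ 2 * 2 <= s ^+ 2 * pi by rewrite ler_wpM2l ?sqr_ge0 ?pi_ge2.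
  by move: r36; rewrite rr mulr2n; lra.
have sq4 (x : R) : x ^+ 4 = (x ^+ 2) ^+ 2 by rewrite -exprM.
have M4 : (\int[P]_w ((U w - m) ^+ 4)%:E <= B%:E)%E.
  rewrite (transfer (normal_prob m s) (fun x => (x - m) ^+ 4) PE); last 2 first.
  - by apply: measurable_funX; apply: measurable_funB.
  - by move=> x; rewrite exprn_even_ge0.
  apply: le_trans (normal_central_fourth_moment m s0) _.
  rewrite lee_fin ler_pM2l// sq4.
  by have := sqr_ge0 s; nra.
have mUm : measurable_fun setT (fun w => (U w - m) ^+ 4).
  by apply: measurable_funX; apply: measurable_funB.
have p40 x : 0 <= x ^+ 4 :> R by rewrite exprn_even_ge0.
have LM4 : mean_abs_le P (fun w => (U w - m) ^+ 4) B by exact: mean_abs_le_ge0.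
have LU2 : mean_abs_le P (fun w => U w ^+ 2) 1.
  apply: mean_abs_le_ge0; [exact: measurable_funX|by move=> w; exact: sqr_ge0|].
  by rewrite U2.
have m2 : m ^+ 2 <= 3 + B.
  have [_] : mean_abs_le P (cst (m ^+ 2)) (`|2| * 1 + `|1| + B).
    apply: mean_abs_le_dominated (mean_abs_leD (mean_abs_leD
      (mean_abs_leZ 2 LU2) (mean_abs_le_cst P 1)) LM4) => //= w.
    rewrite ger0_norm ?sqr_ge0// sq4.
    have := sqr_ge0 (U w + U w - m); have := sqr_ge0 ((U w - m) ^+ 2 - 1); nra.
  rewrite (_ : (\int[P]_w _)%E = (m ^+ 2)%:E).
    by rewrite lee_fin !ger0_norm//; lra.
  under eq_integral do rewrite /= ger0_norm ?sqr_ge0//.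
  rewrite (integral_cst P measurableT (m ^+ 2)%:E).
  by rewrite [X in (_ * X)%E]probability_setT mule1.
have U4 : mean_abs_le P (fun w => U w ^+ 4) (`|8| * (`|m ^+ 4| + B)).
  apply: mean_abs_le_dominated (mean_abs_leZ 8 (mean_abs_leD
      (mean_abs_le_cst P (m ^+ 4)) LM4)) => /=; first exact: measurable_funX.
  move=> w; rewrite ger0_norm//.
  have h (x y : R) : (x + y) ^+ 4 <= 8 * (x ^+ 4 + y ^+ 4).
    rewrite !sq4; have := sqr_ge0 (x - y); have := sqr_ge0 (x ^+ 2 - y ^+ 2).
    have := sqr_ge0 (x + y).
    have : (x + y) ^+ 2 <= 2 * (x ^+ 2 + y ^+ 2) by have := sqr_ge0 (x - y); nra.
    nra.
  by have := h m (U w - m); rewrite addrCA subrr addr0.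
have := integral_le_mean_abs _ U4 => /(_ (fun w => p40 (U w))) {}U4.
apply: le_trans U4 _; rewrite lee_fin !ger0_norm// /K ler_pM2l// lerD2r sq4.
by have := sqr_ge0 m; nra.
Qed.

(** * Orthogonality to the past of an independent sequence *)

(** By independence the joint law of X and Y is the product of their laws, and
the inner integral of Fubini's theorem vanishes. *)
Lemma independent_integral_prod0 d d1 d2 (T : measurableType d)
    (T1 : measurableType d1) (T2 : measurableType d2) (R : realType)
    (P : probability T R) (X : {RV P >-> T1}) (Y : {RV P >-> T2})
    (f : T1 -> R) (g : T2 -> R) :
  (forall A B, measurable A -> measurable B ->
     P (X @^-1` A `&` Y @^-1` B) = (P (X @^-1` A) * P (Y @^-1` B))%E) ->
  measurable_fun setT f -> measurable_fun setT g ->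
  P.-integrable setT (EFin \o (g \o Y)) ->
  (\int[P]_w (g (Y w))%:E = 0)%E ->
  P.-integrable setT (fun w => (f (X w) * g (Y w))%:E) ->
  (\int[P]_w (f (X w) * g (Y w))%:E = 0)%E.
Proof.
move=> XY mf mg ig g0 ifg.
pose phi w := (X w, Y w).
have mphi : measurable_fun setT phi by apply: measurable_fun_pair.
pose h (z : T1 * T2) : \bar R := (f z.1 * g z.2)%:E.
have mh : measurable_fun setT h.
  by apply/measurable_EFinP/measurable_funM; apply: measurableT_comp.
have joint A : measurable A ->
    (distribution P X \x distribution P Y)%E A = pushforward P phi A.
  by move=> mA; exact: product_measure_unique.
have -> : (\int[P]_w (f (X w) * g (Y w))%:E =
    \int[pushforward P phi]_z h z)%E.
  by rewrite (integral_pushforward mphi mh).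
have -> : (\int[pushforward P phi]_z h z =
    \int[distribution P X \x distribution P Y]_z h z)%E.
  by apply: eq_measure_integral => A mA _; exact/esym/joint.
have ih : (distribution P X \x distribution P Y)%E.-integrable setT h.
  have /integrableP[_ hoo] := integrable_pushforward mphi mh (D := setT) ifg measurableT.
  apply/integrableP; split=> //.
  rewrite (eq_measure_integral (pushforward P phi))// => A mA _.
  exact: joint.
rewrite -integral12_prod_meas1//.
apply: integral0_eq => x _; rewrite /fubini_F /h/=.
under eq_integral do rewrite EFinM.
rewrite integralZl//; last first.
  by apply: integrable_pushforward => //; exact/measurable_EFinP.
rewrite integral_distribution//; last exact/measurable_EFinP.
by rewrite [X in (_ * X)%E](_ : _ = 0%E) ?mule0.
Qed.

(** The finite intersections of events on W 0, ..., W (n - 1): a pi-system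
generating the past of time n. *)
Definition past_cylinder (T T' : Type) (m : set (set T')) (W : nat -> T -> T')
    (n : nat) : set (set T) :=
  [set C | exists2 A : nat -> set T', (forall i, m (A i)) &
     C = \bigcap_(i in `I_n) (W i @^-1` A i)].

Lemma past_cylinderI d (T : Type) (T' : measurableType d) (W : nat -> T -> T') n :
  setI_closed (past_cylinder measurable W n).
Proof.
move=> _ _ [A mA ->] [B mB ->]; exists (fun i => A i `&` B i).
  by move=> i; exact: measurableI.
by rewrite -bigcapI; apply: eq_bigcapr => i _; rewrite preimage_setI.
Qed.

Lemma past_cylinder_measurable d d' (T : measurableType d)
    (T' : measurableType d') (W : nat -> T -> T') n :
  (forall i, measurable_fun setT (W i)) ->
  past_cylinder measurable W n `<=` measurable.
Proof.
move=> mW _ [A mA ->]; apply: fin_bigcap_measurable => [|i _].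
  exact: finite_II.
by rewrite -[X in measurable X]setTI; exact: mW.
Qed.

Lemma past_cylinder_coordinate d d' (T : measurableType d)
    (T' : measurableType d') (W : nat -> T -> T') n k (A : set T') :
  (k < n)%N -> measurable A -> past_cylinder measurable W n (W k @^-1` A).
Proof.
move=> kn mA; exists (fun i => if i == k then A else setT).
  by move=> i; case: ifP.
apply/seteqP; split => [w Aw i _ /=|w /(_ k kn)/=].
  by case: eqP => // ->.
by rewrite eqxx.
Qed.

(** Pi-lambda argument: E |-> P (E and W n in B) and E |-> P E * P (W n in B)
are finite measures that agree on cylinders by mutual independence. *)
Lemma independent_past d d' (T : measurableType d) (T' : measurableType d')
    (R : realType) (P : probability T R) (W : nat -> T -> T') n (E : set T)
    (B : set T') :
  (forall i, measurable_fun setT (W i)) -> mutually_independent P W ->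
  <<s past_cylinder measurable W n >> E -> measurable B ->
  P (E `&` W n @^-1` B) = (P E * P (W n @^-1` B))%E.
Proof.
move=> mW indW pE mB.
have mWB : measurable (W n @^-1` B) by rewrite -[X in measurable X]setTI; exact: mW.
have PWB : P (W n @^-1` B) = (fine (P (W n @^-1` B)))%:E.
  by rewrite fineK// fin_num_measure.
have p0 : 0 <= fine (P (W n @^-1` B)) by exact: fine_ge0.
pose m1 : {measure set T -> \bar R} := mrestr P mWB.
pose m2 : {measure set T -> \bar R} := mscale (NngNum p0) P.
have m2E A : m2 A = (P A * P (W n @^-1` B))%E.
  by rewrite [X in (_ * X)%E]PWB muleC.
rewrite -m2E; suff : m1 E = m2 E by [].
apply: (@g_sigma_algebra_measure_unique _ _ _ (past_cylinder measurable W n) _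
  (fun=> setT)) pE.
- exact: past_cylinder_measurable.
- move=> _; exists (fun=> setT) => //.
  by apply/esym/seteqP; split.
- by rewrite bigcup_const.
- exact: past_cylinderI.
- move=> _ [A mA ->]; rewrite m2E.
  pose A' i := if (i < n)%N then A i else B.
  have mA' i : measurable (A' i) by rewrite /A'; case: ifP.
  have bigE (F : nat -> set T) k : \bigcap_(j in [set` iota 0 k]) F j = \bigcap_(j in `I_k) F j.
    by congr (\bigcap_(j in _) F j); apply/seteqP; split => j /=; rewrite mem_iota.
  have A'E : \bigcap_(j in `I_n.+1) (W j @^-1` A' j) =
      \bigcap_(j in `I_n) (W j @^-1` A j) `&` W n @^-1` B.
    apply/seteqP; split => [w h|w [h Bw] j /= jn].
      split; last by have := h n (ltnSn n); rewrite /A' ltnn.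
      by move=> j /= jn; have := h j (ltnW jn); rewrite /A' jn.
    by rewrite /A'; case: ifPn => [/h//|]; rewrite -leqNgt => nj;
      rewrite (_ : j = n)//; apply/eqP; rewrite eqn_leq -ltnS jn.
  have := indW (iota 0 n.+1) A' (iota_uniq _ _) mA'.
  have := indW (iota 0 n) A (iota_uniq _ _) mA.
  rewrite !bigE A'E => -> hA'; rewrite -[LHS]/(P (_ `&` _)) hA'.
  rewrite -addn1 iotaD big_cat/= big_seq1 {2}/A' add0n ltnn; congr (_ * _)%E.
  rewrite big_seq [RHS]big_seq; apply: eq_bigr => i; rewrite mem_iota/= add0n => ni.
  by rewrite /A' ni.
- move=> _; rewrite -[X in (X < _)%E]/(P (_ `&` _)).
  by rewrite (le_lt_trans (probability_le1 P _))// ?ltry//; exact: measurableI.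
Qed.

(** Measurability with respect to the sigma-algebra of the past of time n,
regarded as a second measurable structure on the same carrier T. *)
Definition past_measurable d d' (T : measurableType d) (T' : measurableType d')
    (R : realType) (W : nat -> T -> T') (n : nat) (f : T -> R) : Prop :=
  measurable_fun
    (setT : set (g_sigma_algebraType (past_cylinder measurable W n))) f.

Lemma past_measurable_id d d' (T : measurableType d) (T' : measurableType d')
    (W : nat -> T -> T') n :
  (forall i, measurable_fun setT (W i)) ->
  measurable_fun setT
    (idfun : T -> g_sigma_algebraType (past_cylinder measurable W n)).
Proof.
move=> mW _ A mA; rewrite setTI preimage_id.
apply: smallest_sub mA; first exact: sigma_algebra_measurable.
exact: past_cylinder_measurable.
Qed.

Lemma past_measurableT d d' (T : measurableType d) (T' : measurableType d')
    (R : realType) (W : nat -> T -> T') n (f : T -> R) :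
  (forall i, measurable_fun setT (W i)) ->
  past_measurable W n f -> measurable_fun setT f.
Proof.
by move=> mW mf; exact: (measurableT_comp mf (past_measurable_id mW)).
Qed.

Lemma past_measurable_coordinate d d' (T : measurableType d)
    (T' : measurableType d') (R : realType) (W : nat -> T -> T') n k
    (g : T' -> R) :
  (k < n)%N -> measurable_fun setT g -> past_measurable W n (g \o W k).
Proof.
move=> kn mg _ A mA; rewrite setTI comp_preimage.
apply: sub_sigma_algebra; apply: past_cylinder_coordinate => //.
by rewrite -[X in measurable X]setTI; exact: mg.
Qed.

Lemma past_measurableW d d' (T : measurableType d) (T' : measurableType d')
    (R : realType) (W : nat -> T -> T') n m (f : T -> R) :
  (n <= m)%N -> past_measurable W n f -> past_measurable W m f.
Proof.
move=> nm mf _ A mA; have := mf measurableT A mA.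
apply: smallest_sub; first exact: smallest_sigma_algebra.
move=> _ [B mB ->]; apply: sub_sigma_algebra.
exists (fun i => if (i < n)%N then B i else setT).
  by move=> i; case: ifP.
apply/seteqP; split => [w h i im /=|w h i /= ni].
  by case: ifPn => // ni; exact: h.
by have := h i (leq_trans ni nm); rewrite ni.
Qed.

Lemma past_orthogonal d d' (T : measurableType d) (T' : measurableType d')
    (R : realType) (P : probability T R) (W : nat -> T -> T') n
    (f : T -> R) (g : T' -> R) :
  (forall i, measurable_fun setT (W i)) -> mutually_independent P W ->
  past_measurable W n f -> measurable_fun setT g ->
  P.-integrable setT (EFin \o (g \o W n)) ->
  (\int[P]_w (g (W n w))%:E = 0)%E ->
  P.-integrable setT (fun w => (f w * g (W n w))%:E) ->
  (\int[P]_w (f w * g (W n w))%:E = 0)%E.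
Proof.
move=> mW indW mf mg.
(* the past is the identity of T, read with values in the coarser structure *)
pose X : {RV P >-> g_sigma_algebraType (past_cylinder measurable W n)} :=
  HB.pack (idfun : T -> g_sigma_algebraType (past_cylinder measurable W n))
    (isMeasurableFun.Build _ _ _ _ _ (past_measurable_id mW)).
pose Y : {RV P >-> T'} := HB.pack (W n) (isMeasurableFun.Build _ _ _ _ _ (mW n)).
apply: (@independent_integral_prod0 _ _ _ _ _ _ _ P X Y f g) => // A B mA mB.
exact: independent_past.
Qed.

(** * Empirical covariances of autoregressive processes *)

Section autoregression.
Context d (T : measurableType d) (R : realType) (P : probability T R).
Context d' (T' : measurableType d') (W : nat -> T -> T').
Local Notation L1 := (mean_abs_le P).
Local Notation E f := (\int[P]_w (f w)%:E)%E.

(** The sequence u need not be xi or eta itself: one pair of driving variables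
W n yields both through the two projections p. The index is shifted because
W n carries the innovations of time n + 1. *)
Definition innovation (K : R) (u : nat -> T -> R) (p : T' -> R) : Prop :=
  [/\ measurable_fun setT p, forall n, u n.+1 = p \o W n,
      forall n, L1 (fun w => u n.+1 w ^+ 4) K &
      forall n, E (u n.+1) = 0%E].

Lemma mean_sq_orthogonalD (f g : T -> R) a b :
  measurable_fun setT f -> measurable_fun setT g ->
  L1 (fun w => f w ^+ 2) a -> L1 (fun w => g w ^+ 2) b ->
  E (fun w => f w * g w) = 0%E -> L1 (fun w => (f w + g w) ^+ 2) (a + b).
Proof.
move=> mf mg f2 g2 fg0.
have mfg : measurable_fun setT (fun w => f w * g w) by exact: measurable_funM.
have Lfg : L1 (fun w => f w * g w) (a + b).
  apply: mean_abs_le_dominated (mean_abs_leD f2 g2) => // w.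
  exact: normM_le_sqD.
apply: mean_abs_le_ge0.
- by apply: measurable_funX; exact: measurable_funD.
- by move=> w; exact: sqr_ge0.
have i1 := mean_abs_le_integrable f2; have i2 := mean_abs_le_integrable g2.
have i3 := mean_abs_le_integrable (mean_abs_leZ 2 Lfg).
have -> : (\int[P]_w ((f w + g w) ^+ 2)%:E
    = \int[P]_w (((f w ^+ 2)%:E + (2 * (f w * g w))%:E) + (g w ^+ 2)%:E))%E.
  by apply: eq_integral => w _; rewrite -!EFinD; congr EFin; ring.
rewrite integralD//; last exact: integrableD.
rewrite integralD//.
have -> : (\int[P]_w (2 * (f w * g w))%:E = 0)%E.
  under eq_integral do rewrite EFinM.
  by rewrite integralZl//; [rewrite [X in (_ * X)%E]fg0 mule0|exact: mean_abs_le_integrable Lfg].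
rewrite adde0 EFinD; apply: leeD.
  by apply: integral_le_mean_abs f2 => w; exact: sqr_ge0.
by apply: integral_le_mean_abs g2 => w; exact: sqr_ge0.
Qed.

(** Orthogonality of the increments is asked only when S n is square integrable,
which the induction provides: the integrability needed to prove it comes from
there. *)
Lemma mean_sq_martingale (S D : nat -> T -> R) (K : R) :
  0 <= K -> (forall w, S 0%N w = 0) -> (forall n w, S n.+1 w = S n w + D n w) ->
  (forall n, measurable_fun setT (S n)) ->
  (forall n, measurable_fun setT (D n)) ->
  (forall n, L1 (fun w => D n w ^+ 2) K) ->
  (forall n c, L1 (fun w => S n w ^+ 2) c -> E (fun w => S n w * D n w) = 0%E) ->
  forall n, L1 (fun w => S n w ^+ 2) (n%:R * K).
Proof.
move=> K0 S0 SD mS mD D2 SD0; elim=> [|n IH].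
  rewrite mul0r; apply: mean_abs_le_ge0.
  - exact: measurable_funX.
  - by move=> w; exact: sqr_ge0.
  - by rewrite integral0_eq// => w _; rewrite S0 expr0n.
have -> : (fun w => S n.+1 w ^+ 2) = (fun w => (S n w + D n w) ^+ 2).
  by apply/funext => w; rewrite SD.
have -> : n.+1%:R * K = n%:R * K + K by rewrite -natr1 mulrDl mul1r.
exact: mean_sq_orthogonalD (SD0 _ _ IH).
Qed.

Definition ar (alpha : R) (u : nat -> T -> R) (n : nat) (w : T) : R :=
  AR1 alpha (u^~ w) n.

Lemma ar_past alpha K u p n : innovation K u p -> past_measurable W n (ar alpha u n).
Proof.
move=> [mp uE _ _]; elim: n => [|n IH]; first exact: measurable_cst.
apply: measurable_funD.
  by apply: measurable_funM => //; exact: past_measurableW IH.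
by rewrite uE; exact: past_measurable_coordinate.
Qed.

Lemma ar_fourth alpha K u p n : (forall i, measurable_fun setT (W i)) ->
  `|alpha| < 1 -> innovation K u p ->
  L1 (fun w => ar alpha u n w ^+ 4) (K / (1 - `|alpha|) ^+ 4).
Proof.
move=> mW a1 Iu; have [mp uE u4 _] := Iu.
have b0 : 0 < 1 - `|alpha| by rewrite subr_gt0.
have K0 : 0 <= K by exact: mean_abs_le_bound_ge0 (u4 0%N).
elim: n => [|n IH].
  have -> : (fun w => ar alpha u 0 w ^+ 4) = cst 0.
    by apply/funext => w; rewrite /ar/= expr0n.
  apply: mean_abs_leW (mean_abs_le_cst P 0).
  by rewrite normr0 divr_ge0// exprn_ge0// ltW.
set M := K / _ in IH *.
have ME : M = `| `|alpha| | * M + `|((1 - `|alpha|) ^+ 3)^-1| * K.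
  rewrite normr_id (@ger0_norm _ _^-1) ?invr_ge0 ?exprn_ge0 ?(ltW b0)// /M.
  by field; rewrite gt_eqF.
rewrite ME.
apply: mean_abs_le_dominated (mean_abs_leD (mean_abs_leZ _ IH) (mean_abs_leZ _ (u4 n))).
  apply: measurable_funX.
  by apply: (past_measurableT mW); exact: ar_past Iu.
move=> w; rewrite ger0_norm ?exprn_even_ge0//.
exact: convex_fourth.
Qed.

Lemma ar_sum_id (alpha : R) (u : nat -> T -> R) n w :
  (1 - alpha) * (\sum_(1 <= i < n.+1) ar alpha u i w) + alpha * ar alpha u n w
  = \sum_(1 <= i < n.+1) u i w.
Proof.
elim: n => [|n IH]; first by rewrite !big_geq// /ar/= !mulr0 addr0.
rewrite !(big_nat_recr n.+1)//= -IH {2 3}/ar/= -/(ar alpha u n w); ring.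
Qed.

(** In each summand on the right the first two terms are a past factor times a
current innovation, and the third is a product of current innovations, recentred
by rho: if E (u v) = rho, the right-hand side is a martingale. *)
Lemma ar_sum_mul_id (alpha rho : R) (u v : nat -> T -> R) n w :
  (1 - alpha ^+ 2) * (\sum_(1 <= i < n.+1) ar alpha u i w * ar alpha v i w)
    + alpha ^+ 2 * (ar alpha u n w * ar alpha v n w) - n%:R * rho
  = \sum_(0 <= i < n) (alpha * (ar alpha u i w * v i.+1 w)
      + alpha * (ar alpha v i w * u i.+1 w)
      + (u i.+1 w * v i.+1 w - rho)).
Proof.
elim: n => [|n IH].
  by rewrite !big_geq// /ar/= !mulr0 mul0r subr0 addr0.
rewrite big_nat_recr// [RHS]big_nat_recr//= -IH -natr1.
rewrite (_ : ar alpha u n.+1 w = alpha * ar alpha u n w + u n.+1 w)//.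
rewrite (_ : ar alpha v n.+1 w = alpha * ar alpha v n w + v n.+1 w)//.
ring.
Qed.

Lemma innovation_L1 K u p n : (forall i, measurable_fun setT (W i)) ->
  innovation K u p -> L1 (u n.+1) (1 + K).
Proof.
move=> mW [mp uE u4 _]; rewrite -[X in X + _]normr1.
apply: mean_abs_le_dominated (mean_abs_leD (mean_abs_le_cst P 1) (u4 n)).
  by rewrite uE; exact: measurableT_comp.
move=> w /=; move: (u n.+1 w) => x; rewrite (exprM x 2 2) ler_norml.
have := sqr_ge0 (x ^+ 2 - 1); have := sqr_ge0 (x + 1); have := sqr_ge0 (x - 1).
by move=> *; apply/andP; split; nra.
Qed.

Lemma innovation_past_orthogonal K u p n f k :
  (forall i, measurable_fun setT (W i)) -> mutually_independent P W ->
  innovation K u p -> past_measurable W n f ->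
  L1 (fun w => f w * u n.+1 w) k -> E (fun w => f w * u n.+1 w) = 0%E.
Proof.
move=> mW indW Iu pf; have := innovation_L1 n mW Iu; move: Iu.
move=> [mp uE _ u0]; have := u0 n; rewrite uE => E0 Lu Lfu.
apply: (@past_orthogonal _ _ _ _ _ P W n f p) => //; first exact: mean_abs_le_integrable Lu.
exact: mean_abs_le_integrable Lfu.
Qed.

Lemma innovation_sum_sq K u p n :
  (forall i, measurable_fun setT (W i)) -> mutually_independent P W ->
  innovation K u p ->
  L1 (fun w => (\sum_(1 <= i < n.+1) u i w) ^+ 2) (n%:R * (1 + K)).
Proof.
move=> mW indW Iu; have [mp uE u4 u0] := Iu.
have K0 : 0 <= K by exact: mean_abs_le_bound_ge0 (u4 0%N).
have mu i : measurable_fun setT (u i.+1) by rewrite uE; exact: measurableT_comp.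
pose S n w := \sum_(0 <= i < n) u i.+1 w.
have pS k : past_measurable W k (S k).
  elim: k => [|k IH].
    rewrite (_ : S 0 = cst 0); first exact: measurable_cst.
    by apply/funext => w; rewrite /S big_geq.
  rewrite (_ : S k.+1 = (fun w => S k w + u k.+1 w)); last first.
    by apply/funext => w; rewrite /S big_nat_recr.
  apply: measurable_funD; first exact: past_measurableW IH.
  by rewrite uE; exact: past_measurable_coordinate.
have mS k : measurable_fun setT (S k) by apply: (past_measurableT mW); exact: pS.
have u2 k : L1 (fun w => u k.+1 w ^+ 2) (1 + K).
  rewrite -[X in X + _]normr1.
  apply: mean_abs_le_dominated (mean_abs_leD (mean_abs_le_cst P 1) (u4 k)).
    exact: measurable_funX.
  by move=> w /=; rewrite ger0_norm ?sqr_ge0// sq_le_fourth1.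
under eq_fun do rewrite big_add1.
apply: (@mean_sq_martingale S (fun i => u i.+1) (1 + K)) => //.
- by rewrite addr_ge0.
- by move=> w; rewrite /S big_geq.
- by move=> k w; rewrite /S big_nat_recr.
- move=> k c S2.
  apply: (@innovation_past_orthogonal K u p k (S k) (c + (1 + K))) => //.
  apply: mean_abs_le_dominated (mean_abs_leD S2 (u2 k)).
    exact: measurable_funM.
  by move=> w; exact: normM_le_sqD.
Qed.

Definition ar_sum_const (alpha K : R) : R :=
  2 * ((1 - alpha) ^- 2) * (2 + K + K / (1 - `|alpha|) ^+ 4).

(** By [ar_sum_id], (1 - alpha) times the sum is the sum of the innovations, whose
variance is of order n, up to one term of bounded second moment. *)
Lemma ar_sum_sq alpha K u p n :
  (forall i, measurable_fun setT (W i)) -> mutually_independent P W ->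
  `|alpha| < 1 -> innovation K u p -> (0 < n)%N ->
  L1 (fun w => (\sum_(1 <= i < n.+1) ar alpha u i w) ^+ 2)
    (n%:R * ar_sum_const alpha K).
Proof.
move=> mW indW a1 Iu n0.
have X4 := ar_fourth n mW a1 Iu.
have U2 := innovation_sum_sq n mW indW Iu.
rewrite /ar_sum_const; set M := K / _ in X4 *.
have b0 : 0 < 1 - alpha by rewrite subr_gt0; apply: le_lt_trans a1; exact: ler_norm.
have c0 : 0 < 2 * ((1 - alpha) ^- 2) :> R by rewrite mulr_gt0// invr_gt0 exprn_gt0.
have n1 : 1 <= n%:R :> R by rewrite ler1n.
have M0 : 0 <= M := mean_abs_le_bound_ge0 X4.
apply: (@mean_abs_leW _ _ _ _ _ (`|2 * ((1 - alpha) ^- 2)| * (n%:R * (1 + K) + (`|1| + M)))).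
  rewrite gtr0_norm// normr1 mulrCA ler_pM2l//; nra.
apply: mean_abs_le_dominated (mean_abs_leZ _ (mean_abs_leD U2 (mean_abs_leD (mean_abs_le_cst P 1) X4))).
  apply: measurable_funX; apply: measurable_sum => i.
  by apply: (past_measurableT mW); exact: ar_past Iu.
move=> w; rewrite ger0_norm ?sqr_ge0// -(ar_sum_id alpha u) /=.
move: (\sum_(_ <= _ < _) _) (ar alpha u n w) => s x.
have -> : s ^+ 2 = (1 - alpha) ^- 2 * ((1 - alpha) * s) ^+ 2.
  by field; rewrite gt_eqF.
rewrite -[leRHS]mulrA [leRHS]mulrCA ler_pM2l ?invr_gt0 ?exprn_gt0//.
have a2 : alpha ^+ 2 <= 1 by rewrite -real_normK ?num_real// exprn_ile1// ltW.
set y := (1 - alpha) * s; rewrite (exprM x 2 2).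
have h : (alpha * x) ^+ 2 <= x ^+ 2 by rewrite exprMn ler_piMl ?sqr_ge0.
have := sqr_ge0 (y + 2 * (alpha * x)); have := sqr_ge0 (x ^+ 2 - 1); nra.
Qed.

Definition emp_cov_const (alpha K rho : R) : R :=
  let M := K / (1 - `|alpha|) ^+ 4 in
  let KD := 2 * (M + K) + 2 * (M + K) + (2 * (K + K) + 4 * rho ^+ 2) in
  (1 + KD) + (1 + (M + M)) + (ar_sum_const alpha K + ar_sum_const alpha K).

Section pair.
Context (alpha K rho : R) (u v : nat -> T -> R) (p q : T' -> R)
  (mW : forall i, measurable_fun setT (W i)) (indW : mutually_independent P W)
  (a1 : `|alpha| < 1) (Iu : innovation K u p) (Iv : innovation K v q)
  (uv : forall n, E (fun w => u n.+1 w * v n.+1 w) = rho%:E).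

Let M := K / (1 - `|alpha|) ^+ 4.
Let X := ar alpha u.
Let Y := ar alpha v.
Let D i w := alpha * (X i w * v i.+1 w) + alpha * (Y i w * u i.+1 w)
  + (u i.+1 w * v i.+1 w - rho).
Let S n w := \sum_(0 <= i < n) D i w.
Let KD := 2 * (M + K) + 2 * (M + K) + (2 * (K + K) + 4 * rho ^+ 2).

Let X4 n : L1 (fun w => X n w ^+ 4) M. Proof. exact: ar_fourth Iu. Qed.
Let Y4 n : L1 (fun w => Y n w ^+ 4) M. Proof. exact: ar_fourth Iv. Qed.
Let u4 n : L1 (fun w => u n.+1 w ^+ 4) K. Proof. by case: Iu. Qed.
Let v4 n : L1 (fun w => v n.+1 w ^+ 4) K. Proof. by case: Iv. Qed.
Let mp : measurable_fun setT p. Proof. by case: Iu. Qed.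
Let mq : measurable_fun setT q. Proof. by case: Iv. Qed.
Let uE n : u n.+1 = p \o W n. Proof. by case: Iu. Qed.
Let vE n : v n.+1 = q \o W n. Proof. by case: Iv. Qed.
Let u0 n : E (u n.+1) = 0%E. Proof. by case: Iu. Qed.
Let v0 n : E (v n.+1) = 0%E. Proof. by case: Iv. Qed.
Let pX n : past_measurable W n (X n). Proof. exact: ar_past Iu. Qed.
Let pY n : past_measurable W n (Y n). Proof. exact: ar_past Iv. Qed.
Let pu n : past_measurable W n.+1 (u n.+1).
Proof. by rewrite uE; exact: past_measurable_coordinate. Qed.
Let pv n : past_measurable W n.+1 (v n.+1).
Proof. by rewrite vE; exact: past_measurable_coordinate. Qed.
Let mX n : measurable_fun setT (X n). Proof. by apply: (past_measurableT mW); exact: pX. Qed.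
Let mY n : measurable_fun setT (Y n). Proof. by apply: (past_measurableT mW); exact: pY. Qed.
Let mu n : measurable_fun setT (u n.+1). Proof. by apply: (past_measurableT mW); exact: pu. Qed.
Let mv n : measurable_fun setT (v n.+1). Proof. by apply: (past_measurableT mW); exact: pv. Qed.

Let pD n : past_measurable W n.+1 (D n).
Proof.
apply: measurable_funD; last first.
  by apply: measurable_funB => //; apply: measurable_funM; [exact: pu|exact: pv].
apply: measurable_funD; apply: measurable_funM => //; apply: measurable_funM.
- exact: past_measurableW (leqnSn n) (@pX n).
- exact: pv.
- exact: past_measurableW (leqnSn n) (@pY n).
- exact: pu.
Qed.

Let pS n : past_measurable W n (S n).
Proof.
elim: n => [|n IH].
  rewrite (_ : S 0 = cst 0); first exact: measurable_cst.
  by apply/funext => w; rewrite /S big_geq.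
rewrite (_ : S n.+1 = (fun w => S n w + D n w)); last first.
  by apply/funext => w; rewrite /S big_nat_recr.
by apply: measurable_funD; [exact: past_measurableW IH|exact: pD].
Qed.
Let mS n : measurable_fun setT (S n). Proof. by apply: (past_measurableT mW); exact: pS. Qed.
Let mD n : measurable_fun setT (D n). Proof. by apply: (past_measurableT mW); exact: pD. Qed.

Let sq4 (x : R) : x ^+ 4 = (x ^+ 2) ^+ 2. Proof. by rewrite -exprM. Qed.

Let D2 n : L1 (fun w => D n w ^+ 2) KD.
Proof.
have -> : KD = `|2| * (M + K) + `|2| * (M + K) + (`|2| * (K + K) + `|4 * rho ^+ 2|).
  by rewrite !ger0_norm// mulr_ge0// sqr_ge0.
apply: mean_abs_le_dominated (mean_abs_leD (mean_abs_leD
   (mean_abs_leZ 2 (mean_abs_leD (X4 n) (v4 n)))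
   (mean_abs_leZ 2 (mean_abs_leD (Y4 n) (u4 n))))
   (mean_abs_leD (mean_abs_leZ 2 (mean_abs_leD (u4 n) (v4 n)))
                 (mean_abs_le_cst P (4 * rho ^+ 2)))).
  exact: measurable_funX.
move=> w; rewrite ger0_norm ?sqr_ge0// /D/= !sq4.
move: (X n w) (Y n w) (u n.+1 w) (v n.+1 w) => x y a b.
have am (s t : R) : 2 * (s * t) ^+ 2 <= (s ^+ 2) ^+ 2 + (t ^+ 2) ^+ 2.
  by have := sqr_ge0 (s ^+ 2 - t ^+ 2); nra.
have al (s : R) : (alpha * s) ^+ 2 <= s ^+ 2.
  rewrite exprMn ler_piMl ?sqr_ge0//.
  by rewrite -real_normK ?num_real// exprn_ile1// ltW.
have four (s t z r : R) : (s + t + (z - r)) ^+ 2 <= 4 * (s ^+ 2 + t ^+ 2 + z ^+ 2 + r ^+ 2).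
  have := sqr_ge0 (s - t); have := sqr_ge0 (s - z); have := sqr_ge0 (s + r).
  have := sqr_ge0 (t - z); have := sqr_ge0 (t + r); have := sqr_ge0 (z + r); nra.
have := four (alpha * (x * b)) (alpha * (y * a)) (a * b) rho.
have := al (x * b); have := al (y * a).
have := am x b; have := am y a; have := am a b; lra.
Qed.

Let E0Z c (f : T -> R) k : L1 f k -> E f = 0%E -> E (fun w => c * f w) = 0%E.
Proof.
move=> Lf Ef; under eq_integral do rewrite EFinM.
by rewrite integralZl//; [rewrite Ef mule0|exact: mean_abs_le_integrable Lf].
Qed.

Let E0D (f g : T -> R) a b : L1 f a -> L1 g b -> E f = 0%E -> E g = 0%E ->
  E (fun w => f w + g w) = 0%E.
Proof.
move=> Lf Lg Ef Eg; under eq_integral do rewrite EFinD.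
rewrite integralD//; [|exact: mean_abs_le_integrable Lf|exact: mean_abs_le_integrable Lg].
by rewrite [X in (X + _)%E]Ef [X in (_ + X)%E]Eg adde0.
Qed.

Let SD0 n c : L1 (fun w => S n w ^+ 2) c -> E (fun w => S n w * D n w) = 0%E.
Proof.
move=> S2.
have mSn := mS n.
have mSX : measurable_fun setT (fun w => S n w * X n w) by exact: measurable_funM.
have mSY : measurable_fun setT (fun w => S n w * Y n w) by exact: measurable_funM.
have muv : measurable_fun setT (fun w => u n.+1 w * v n.+1 w) by exact: measurable_funM.
have L1SXv : L1 (fun w => S n w * X n w * v n.+1 w) (c + (M + K)).
  apply: mean_abs_le_dominated (mean_abs_leD S2 (mean_abs_leD (X4 n) (v4 n))).
    exact: measurable_funM.
  move=> w /=; rewrite -mulrA; apply: le_trans (normM_le_sqD _ _) _.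
  by rewrite lerD2l sqM_le_fourthD.
have L1SYu : L1 (fun w => S n w * Y n w * u n.+1 w) (c + (M + K)).
  apply: mean_abs_le_dominated (mean_abs_leD S2 (mean_abs_leD (Y4 n) (u4 n))).
    exact: measurable_funM.
  move=> w /=; rewrite -mulrA; apply: le_trans (normM_le_sqD _ _) _.
  by rewrite lerD2l sqM_le_fourthD.
have L1uv : L1 (fun w => u n.+1 w * v n.+1 w) (`|1| + (K + K)).
  apply: mean_abs_le_dominated (mean_abs_leD (mean_abs_le_cst P 1)
    (mean_abs_leD (u4 n) (v4 n))) => // w /=.
  have := sqM_le_fourthD (u n.+1 w) (v n.+1 w); rewrite ler_norml => h.
  have := sqr_ge0 (u n.+1 w * v n.+1 w - 1); have := sqr_ge0 (u n.+1 w * v n.+1 w + 1).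
  by move=> *; apply/andP; split; nra.
have L1uvr := mean_abs_leD L1uv (mean_abs_le_cst P (- rho)).
have L1Suv : L1 (fun w => S n w * (u n.+1 w * v n.+1 w - rho))
    (c + (`|2| * (K + K) + `|2 * rho ^+ 2|)).
  apply: mean_abs_le_dominated (mean_abs_leD S2 (mean_abs_leD
    (mean_abs_leZ 2 (mean_abs_leD (u4 n) (v4 n))) (mean_abs_le_cst P (2 * rho ^+ 2)))).
    by apply: measurable_funM => //; exact: measurable_funB.
  move=> w /=; apply: le_trans (normM_le_sqD _ _) _; rewrite lerD2l.
  have := sqM_le_fourthD (u n.+1 w) (v n.+1 w); have := sqr_ge0 (u n.+1 w * v n.+1 w + rho).
  by nra.
have Z1 : E (fun w => S n w * X n w * v n.+1 w) = 0%E.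
  apply: (@innovation_past_orthogonal K v q n _ (c + (M + K))) => //.
  by apply: measurable_funM; [exact: pS|exact: pX].
have Z2 : E (fun w => S n w * Y n w * u n.+1 w) = 0%E.
  apply: (@innovation_past_orthogonal K u p n _ (c + (M + K))) => //.
  by apply: measurable_funM; [exact: pS|exact: pY].
have Z3 : E (fun w => S n w * (u n.+1 w * v n.+1 w - rho)) = 0%E.
  move: L1uvr L1Suv; have := uv n; rewrite uE vE => h L1uvr L1Suv.
  have huv : L1 (fun w => (p \o W n) w * (q \o W n) w) (`|1| + (K + K)).
    by move: L1uv; rewrite uE vE.
  have E0 : (\int[P]_w (p (W n w) * q (W n w) - rho)%:E = 0)%E.
    under eq_integral do rewrite EFinD.
    rewrite integralD//; last 2 first.
    + exact: mean_abs_le_integrable huv.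
    + exact: mean_abs_le_integrable (mean_abs_le_cst P (- rho)).
    rewrite [X in (X + _)%E]h (integral_cst P measurableT (- rho)%:E).
    by rewrite [X in (_ * X)%E]probability_setT mule1 -EFinD subrr.
  have mpq : measurable_fun setT (fun z => p z * q z - rho).
    by apply: measurable_funB => //; exact: measurable_funM.
  exact: (@past_orthogonal _ _ _ _ _ P W n (S n) (fun z => p z * q z - rho) mW indW
    (@pS n) mpq (mean_abs_le_integrable L1uvr) E0 (mean_abs_le_integrable L1Suv)).
under eq_integral => w _.
  rewrite (_ : S n w * D n w = (alpha * (S n w * X n w * v n.+1 w)
    + alpha * (S n w * Y n w * u n.+1 w)) + S n w * (u n.+1 w * v n.+1 w - rho)); last first.
    by rewrite /D; ring.
  over.
have L1a := mean_abs_leZ alpha L1SXv.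
have L1b := mean_abs_leZ alpha L1SYu.
apply: (E0D (mean_abs_leD L1a L1b) L1Suv) => //.
apply: (E0D L1a L1b); [exact: (E0Z alpha L1SXv Z1)|exact: (E0Z alpha L1SYu Z2)].
Qed.

Let S2 n : L1 (fun w => S n w ^+ 2) (n%:R * KD).
Proof.
apply: (@mean_sq_martingale S D KD) => //.
- by apply: mean_abs_le_bound_ge0 (D2 0%N).
- by move=> w; rewrite /S big_geq.
- by move=> k w; rewrite /S big_nat_recr.
Qed.

(** The three error terms are S_n / n, the boundary term X_n Y_n / n and the
product of the two empirical means. The first is of order 1 / sqrt n because
|s| / n <= (1 + s^2 / n) / sqrt n; the others are of order 1 / n. *)
Lemma mean_abs_emp_cov n : (0 < n)%N ->
  L1 (fun w => (1 - alpha ^+ 2) *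
        emp_cov (AR1 alpha (u^~ w)) (AR1 alpha (v^~ w)) n - rho)
    (emp_cov_const alpha K rho / Num.sqrt n%:R).
Proof.
move=> n0; have n0' : 0 < n%:R :> R by rewrite ltr0n.
(* everything is written in powers of i = 1 / sqrt n *)
set i := (Num.sqrt n%:R)^-1.
have i0 : 0 < i by rewrite invr_gt0 sqrtr_gt0.
have i2 : n%:R^-1 = i ^+ 2 by rewrite exprVn sqr_sqrtr// ltW.
have i1 : i <= 1.
  by rewrite invf_le1 ?sqrtr_gt0// -[leLHS]sqrtr1 ler_wsqrtr// ler1n.
have KD0 : 0 <= KD := mean_abs_le_bound_ge0 (D2 0%N).
have SX2 := ar_sum_sq mW indW a1 Iu n0.
have SY2 := ar_sum_sq mW indW a1 Iv n0.
have ni : n%:R * i ^+ 2 = 1 by rewrite -i2 mulfV// gt_eqF.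
set c2 := ar_sum_const alpha K in SX2 SY2.
have c20 : 0 <= c2.
  by have := mean_abs_le_bound_ge0 SX2; rewrite pmulr_rge0.
have bound := mean_abs_leD (mean_abs_leD
  (mean_abs_leZ i (mean_abs_leD (mean_abs_le_cst P 1) (mean_abs_leZ (i ^+ 2) (S2 n))))
  (mean_abs_leZ (i ^+ 2) (mean_abs_leD (mean_abs_le_cst P 1) (mean_abs_leD (X4 n) (Y4 n)))))
  (mean_abs_leZ (i ^+ 4) (mean_abs_leD SX2 SY2)).
apply: mean_abs_leW (mean_abs_le_dominated _ _ bound).
- rewrite !ger0_norm ?exprn_ge0 ?(ltW i0)//.
  rewrite (mulrA (i ^+ 2)) (mulrC (i ^+ 2) n%:R) ni mul1r.
  have -> : i ^+ 4 * (n%:R * c2 + n%:R * c2) = (n%:R * i ^+ 2) * (i ^+ 2 * (c2 + c2)) by ring.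
  rewrite ni mul1r -/i.
  have -> : emp_cov_const alpha K rho = (1 + KD) + (1 + (M + M)) + (c2 + c2) by [].
  have i21 : i ^+ 2 <= i by rewrite expr2 ler_piMl// ltW.
  have M0 : 0 <= M := mean_abs_le_bound_ge0 (X4 n).
  rewrite [leRHS]mulrC [leRHS]mulrDr [X in _ <= X + _]mulrDr.
  apply: lerD; [apply: lerD => //|]; apply: ler_wpM2r => //.
    by rewrite !addr_ge0.
  by rewrite addr_ge0.
- apply: measurable_funB => //; apply: measurable_funM => //.
  apply: measurable_funB; apply: measurable_funM => //.
    by apply: measurable_sum => j; apply: measurable_funM; [exact: mX|exact: mY].
  by apply: measurable_funM; apply: measurable_sum => j; [exact: mX|exact: mY].
- move=> w; rewrite /emp_cov -exprVn i2.
  have Sid : S n w = _ := esym (ar_sum_mul_id alpha rho u v n w).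
  rewrite -/(ar alpha u _ w) in Sid *.
  move: Sid.
  rewrite (_ : \sum_(1 <= i0 < n.+1) AR1 alpha (u^~ w) i0 * AR1 alpha (v^~ w) i0 =
     \sum_(1 <= i0 < n.+1) ar alpha u i0 w * ar alpha v i0 w)//.
  rewrite (_ : \sum_(1 <= i0 < n.+1) AR1 alpha (u^~ w) i0 =
     \sum_(1 <= i0 < n.+1) ar alpha u i0 w)//.
  rewrite (_ : \sum_(1 <= i0 < n.+1) AR1 alpha (v^~ w) i0 =
     \sum_(1 <= i0 < n.+1) ar alpha v i0 w)//.
  rewrite -/X -/Y.
  move: (\sum_(_ <= _ < _) X _ w * Y _ w) (\sum_(_ <= _ < _) X _ w)
    (\sum_(_ <= _ < _) Y _ w) (S n w) (X n w) (Y n w) => XY sX sY s x y sE.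
  have a2 : 0 <= alpha ^+ 2 <= 1.
    by rewrite sqr_ge0/= -real_normK ?num_real// exprn_ile1// ltW.
  have -> : (1 - alpha ^+ 2) * (i ^+ 2 * XY - (i ^+ 2) ^+ 2 * (sX * sY)) - rho
    = i ^+ 2 * s - alpha ^+ 2 * (i ^+ 2 * (x * y)) - (1 - alpha ^+ 2) * (i ^+ 4 * (sX * sY)).
    transitivity ((1 - alpha ^+ 2) * (i ^+ 2 * XY - (i ^+ 2) ^+ 2 * (sX * sY))
      - n%:R * i ^+ 2 * rho); first by rewrite ni mul1r.
    by rewrite sE; ring.
  apply: le_trans (ler_normB _ _) _; apply: lerD.
    apply: le_trans (ler_normB _ _) _; apply: lerD.
      rewrite expr2 -mulrA normrM (gtr0_norm i0) ler_pM2l//=.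
      have := normM_le_sqD 1 (i * s); rewrite mul1r expr1n exprMn; exact.
    rewrite normrM ger0_norm ?sqr_ge0//.
    apply: (@le_trans _ _ `|i ^+ 2 * (x * y)|).
      by rewrite ler_piMl//; case/andP: a2.
    rewrite normrM ger0_norm ?sqr_ge0// ler_wpM2l ?sqr_ge0//=.
    rewrite !sq4 ler_norml.
    have := sqr_ge0 (x - y); have := sqr_ge0 (x + y).
    have := sqr_ge0 (x ^+ 2 - 1); have := sqr_ge0 (y ^+ 2 - 1).
    by move=> *; apply/andP; split; nra.
  have b2 : 0 <= 1 - alpha ^+ 2 <= 1 by case/andP: a2 => *; apply/andP; split; lra.
  rewrite normrM ger0_norm; last by case/andP: b2.
  apply: (@le_trans _ _ `|i ^+ 4 * (sX * sY)|).
    by rewrite ler_piMl//; case/andP: b2.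
  by rewrite normrM ger0_norm ?exprn_ge0 ?(ltW i0)// ler_wpM2l ?exprn_ge0 ?(ltW i0)// normM_le_sqD.
Qed.
End pair.

End autoregression.

(** * The Gaussian tail *)

(** Brings in monotonicity, additivity and total mass of the standard normal
law. *)
Lemma Phi_normal_prob (R : realType) (x : R) :
  (Phi x)%:E = normal_prob 0 1 (`[x, +oo[%classic : set R).
Proof.
rewrite /normal_prob.
have -> : Phi x = fine (\int[lebesgue_measure]_(y in `[x, +oo[) (normal_pdf 0 1 y)%:E)%E.
  rewrite /Phi /Rintegral; congr fine; apply: eq_integral => y _.
  rewrite normal_pdfE ?oner_neq0// /normal_peak /normal_fun subr0 expr1n mul1r.
  by rewrite -(mulr_natl pi 2).
rewrite fineK// -[X in X \is a fin_num]/(normal_prob 0 1 (`[x, +oo[%classic : set R)).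
by rewrite fin_num_measure.
Qed.

Lemma le_Phi (R : realType) (x y : R) : x <= y -> Phi y <= Phi x.
Proof.
move=> xy; rewrite -lee_fin !Phi_normal_prob; apply: le_measure; rewrite ?inE//.
by apply: subset_itvr; rewrite bnd_simp.
Qed.

Lemma PhiN (R : realType) (x : R) : Phi (- x) = 1 - Phi x.
Proof.
apply: EFin_inj; rewrite EFinB !Phi_normal_prob.
have refl : normal_prob 0 1 (`[- x, +oo[%classic : set R) = normal_prob 0 1 (`]-oo, x]%classic : set R).
  rewrite /normal_prob -[x in RHS]opprK ge0_integration_by_substitutionNy//.
  - by apply: eq_integral => y _; rewrite /= !normal_pdfE ?oner_neq0// /normal_fun !subr0 sqrrN.
  - by apply: continuous_subspaceT; exact: continuous_normal_pdf (oner_neq0 _).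
  - by move=> y _; exact: normal_pdf_ge0.
rewrite refl -(@probability_setC _ _ _ (normal_prob 0 1))//.
rewrite setCitvr.
apply/esym/integral_itv_bndo_bndc.
by apply/measurable_EFinP/measurable_funTS; exact: measurable_normal_pdf.
Qed.

Lemma Phi_ge0 (R : realType) (x : R) : 0 <= Phi x.
Proof. by rewrite -lee_fin Phi_normal_prob; exact: measure_ge0. Qed.

(** The Markov inequality for y^4 gives 64 / x already, as x <= x^4. *)
Lemma Phi_le_inv (R : realType) (x : R) : 1 <= x -> Phi x <= 64 / x.
Proof.
move=> x1; rewrite -lee_fin Phi_normal_prob.
pose N : probability (measurableTypeR R) R := normal_prob 0 1.
have Lf : mean_abs_le N (fun y : R => (y - 0) ^+ 4) 64.
  apply: mean_abs_le_ge0.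
  - by apply: measurable_funX; exact: measurable_funB.
  - by move=> y; rewrite exprn_even_ge0.
  - by have := normal_central_fourth_moment 0 (oner_neq0 R); rewrite expr1n mulr1.
have x0 : 0 < x by exact: lt_le_trans x1.
apply: le_trans (mean_abs_le_Markov x0 Lf).
apply: le_measure; rewrite ?inE//.
  rewrite -[X in measurable X]setTI; apply: measurable_fun_ler => //.
  apply: measurableT_comp => //; apply: measurable_funX; exact: measurable_funB.
move=> y /=; rewrite in_itv/= andbT subr0 => xy.
have y1 : 1 <= y by exact: le_trans xy.
rewrite normrX ger0_norm; last exact: le_trans y1.
by rewrite (le_trans xy)// -[leLHS]expr1 ler_weXn2l.
Qed.

Lemma cvg_Phi_pinfty (R : realType) : @Phi R x @[x --> +oo] --> (0 : R).
Proof.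
apply/cvgrPdist_le => e e0; near=> x.
rewrite sub0r normrN ger0_norm ?Phi_ge0//.
have x1 : 1 <= x by near: x; exact: nbhs_pinfty_ge.
apply: le_trans (Phi_le_inv x1) _.
rewrite ler_pdivrMr; last exact: lt_le_trans x1.
rewrite mulrC -ler_pdivrMr//.
Unshelve. all: by end_near. Qed.

(** * Probability of rejection *)

(** The hypothesis keeps b and c positive, so the square root does not vanish:
g * |a| >= |r| / 2 while g * sqrt (b c) <= 3 / 2. *)
Lemma emp_corr_lower (R : realType) (g r a b c : R) : 0 < g -> `|r| <= 1 ->
  `|g * a - r| + `|g * b - 1| + `|g * c - 1| < `|r| / 2 ->
  `|r| / 3 <= `|a / Num.sqrt (b * c)|.
Proof.
move=> g0 r1.
set x := `|g * a - r|; set y := `|g * b - 1|; set z := `|g * c - 1| => h.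
have [x0 y0 z0] : [/\ 0 <= x, 0 <= y & 0 <= z] by split; exact: normr_ge0.
have : `|r| - x <= `|g * a|.
  rewrite lerBlDr; apply: le_trans (ler_normB _ _).
  by rewrite [X in _ <= `|X|](_ : _ = r)//; ring.
rewrite normrM (gtr0_norm g0) => ga.
have y2 : y <= 1 / 2 by lra.
move: (y2); rewrite ler_norml => /andP[yl yr].
have z2 : z <= 1 / 2 by lra.
move: (z2); rewrite ler_norml => /andP[zl zr].
have gb0 : 0 < g * b by lra.
have gc0 : 0 < g * c by lra.
have b0 : 0 < b by rewrite -(pmulr_rgt0 _ g0).
have c0 : 0 < c by rewrite -(pmulr_rgt0 _ g0).
have s0 : 0 < Num.sqrt (b * c) by rewrite sqrtr_gt0 mulr_gt0.
have sE : g * Num.sqrt (b * c) <= 3 / 2.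
  have s2 : (g * Num.sqrt (b * c)) ^+ 2 = (g * b) * (g * c).
    by rewrite exprMn sqr_sqrtr ?mulr_ge0 ?(ltW b0) ?(ltW c0)//; ring.
  by rewrite leNgt; apply/negP => h'; move: s2; nra.
rewrite normrM normfV (gtr0_norm s0) ler_pdivlMr//.
have r3 : 0 <= `|r| / 3 by rewrite divr_ge0.
have gar : `|r| / 2 <= g * `|a| by lra.
rewrite -(ler_pM2l g0) [leLHS]mulrCA.
by apply: le_trans (ler_wpM2l r3 sE) _; apply: le_trans gar; lra.
Qed.

Lemma gaussian_vector2_fst d (T : measurableType d) (R : realType)
    (P : probability T R) (U V : {RV P >-> R}) :
  gaussian_vector2 U V ->
  exists m s, forall A, measurable A -> P (U @^-1` A) = gaussian_law m s A.
Proof.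
move=> /(_ 1 0)[m [s h]]; exists m, s => A mA; rewrite -h//.
by congr (P _); apply/seteqP; split => w /=; rewrite mul1r mul0r addr0.
Qed.

Lemma gaussian_vector2_snd d (T : measurableType d) (R : realType)
    (P : probability T R) (U V : {RV P >-> R}) :
  gaussian_vector2 U V ->
  exists m s, forall A, measurable A -> P (V @^-1` A) = gaussian_law m s A.
Proof.
move=> /(_ 0 1)[m [s h]]; exists m, s => A mA; rewrite -h//.
by congr (P _); apply/seteqP; split => w /=; rewrite mul1r mul0r add0r.
Qed.

Lemma measurable_AR1 d (T : measurableType d) (R : realType) (alpha : R)
    (u : nat -> T -> R) n : (forall i, measurable_fun setT (u i)) ->
  measurable_fun setT (fun w => AR1 alpha (u^~ w) n).
Proof.
move=> mu; elim: n => [|n IH]; first exact: measurable_cst.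
by apply: measurable_funD => //; exact: measurable_funM.
Qed.

Lemma measurable_emp_cov d (T : measurableType d) (R : realType)
    (X Y : nat -> T -> R) n : (forall i, measurable_fun setT (X i)) ->
  (forall i, measurable_fun setT (Y i)) ->
  measurable_fun setT (fun w => emp_cov (X^~ w) (Y^~ w) n).
Proof.
move=> mX mY; apply: measurable_funB; apply: measurable_funM => //.
  by apply: measurable_sum => i; exact: measurable_funM.
by apply: measurable_funM; exact: measurable_sum.
Qed.

Lemma measurable_rejection_region d (T : measurableType d) (R : realType)
    (P : probability T R) (alpha c : R) (xi eta : nat -> {RV P >-> R}) n :
  measurable (rejection_region alpha c xi eta n).
Proof.
have mX (u : nat -> {RV P >-> R}) i :
    measurable_fun setT (fun w => AR1 alpha (fun j => u j w) i).
  exact: (@measurable_AR1 _ _ _ alpha (fun j => u j)).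
rewrite -[X in measurable X]setTI; apply: measurable_fun_ltr => //.
apply: measurableT_comp => //; apply: measurable_funM => //.
rewrite /theta /emp_corr.
have m12 := measurable_emp_cov n (mX xi) (mX eta).
have m11 := measurable_emp_cov n (mX xi) (mX xi).
have m22 := measurable_emp_cov n (mX eta) (mX eta).
apply: measurable_funM => //.
(* the inverse agrees with the power -1, also at 0 *)
under eq_fun do rewrite -powR_inv1 ?sqrtr_ge0//.
apply: (measurableT_comp (measurable_powR _)).
apply: (measurableT_comp (continuous_measurable_fun (@sqrt_continuous R))).
exact: measurable_funM.
Qed.

(** The constant does not depend on the probability space, because neither the
fourth moment bound K nor [emp_cov_const] does. *)
Lemma rejection_probability_lower (R : realType) (alpha r : R) :
  `|alpha| < 1 -> `|r| <= 1 -> r != 0 ->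
  exists C : R, forall (c : R) (n : nat), (0 < n)%N ->
    c < Num.sqrt n%:R * (`|r| / 3) ->
    forall (d : measure_display) (T : measurableType d)
      (P : probability T R) (xi eta : nat -> {RV P >-> R}),
    H_a r xi eta ->
    ((1 - C / Num.sqrt n%:R)%:E <= P (rejection_region alpha c xi eta n))%E.
Proof.
move=> a1 r1 r0; have [K K0 HK] := gaussian_fourth_moment_bound R.
pose C1 := emp_cov_const alpha K r + emp_cov_const alpha K 1 + emp_cov_const alpha K 1.
exists (C1 / (`|r| / 2)) => c n n0 cn d T P xi eta [indW _ pairs].
set W := (fun _ : nat => _) in indW.
have mW i : measurable_fun setT (W i) by apply: measurable_fun_pair.
have mean0 (u : {RV P >-> R}) : ('E_P[u] = 0)%E -> (\int[P]_w (u w)%:E = 0)%E.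
  by rewrite unlock.
have fourth (u : {RV P >-> R}) : (exists m s, forall A, measurable A ->
     P (u @^-1` A) = gaussian_law m s A) -> ('E_P[u] = 0)%E ->
     covariance P u u = 1%E -> mean_abs_le P (fun w => u w ^+ 4) K.
  move=> gu eu cu; apply: mean_abs_le_ge0; last exact: HK.
    exact: measurable_funX.
  by move=> w; rewrite exprn_even_ge0.
have Ix : innovation P W K (fun i => xi i) fst.
  split=> // i;
    have [g [e1 e2] [c1 c2] _] := pairs i.+1 isT; last exact: mean0.
  by apply: fourth => //; exact: gaussian_vector2_fst g.
have Ie : innovation P W K (fun i => eta i) snd.
  split=> // i;
    have [g [e1 e2] [c1 c2] _] := pairs i.+1 isT; last exact: mean0.
  by apply: fourth => //; exact: gaussian_vector2_snd g.
have Exe i : (\int[P]_w (xi i.+1 w * eta i.+1 w)%:E = r%:E)%E.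
  have [g [e1 e2] _ cr] := pairs i.+1 isT; exact: integral_sq_centered cr.
have Exx i : (\int[P]_w (xi i.+1 w * xi i.+1 w)%:E = 1%:E)%E.
  have [g [e1 e2] [c1 _] _] := pairs i.+1 isT; exact: integral_sq_centered c1.
have Eee i : (\int[P]_w (eta i.+1 w * eta i.+1 w)%:E = 1%:E)%E.
  have [g [e1 e2] [_ c2] _] := pairs i.+1 isT; exact: integral_sq_centered c2.
have L12 := mean_abs_emp_cov mW indW a1 Ix Ie Exe n0.
have L11 := mean_abs_emp_cov mW indW a1 Ix Ix Exx n0.
have L22 := mean_abs_emp_cov mW indW a1 Ie Ie Eee n0.
have LZ := mean_abs_leD (mean_abs_leD
  (mean_abs_le_norm L12) (mean_abs_le_norm L11)) (mean_abs_le_norm L22).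
rewrite -!mulrDl -/C1 in LZ; set Z := (X in mean_abs_le P X _) in LZ.
have r20 : 0 < `|r| / 2 by rewrite divr_gt0// normr_gt0.
have PA := mean_abs_le_Markov r20 LZ; have [mZ _] := LZ.
set A := [set w | _] in PA.
have mA : measurable A.
  rewrite -[X in measurable X]setTI; apply: measurable_fun_ler => //.
  exact: measurableT_comp.
have n0' : 0 < Num.sqrt n%:R :> R by rewrite sqrtr_gt0 ltr0n.
have g0 : 0 < 1 - alpha ^+ 2.
  by rewrite subr_gt0 -real_normK ?num_real// exprn_ilt1.
apply: (@le_trans _ _ (P (~` A))).
  rewrite probability_setC// EFinB; apply: leeB => //.
  by rewrite mulrAC.
apply: le_measure; rewrite ?inE; [exact: measurableC|exact: measurable_rejection_region|].
move=> w /= /negP; rewrite -ltNge => Aw.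
have Zw : Z w < `|r| / 2 by apply: le_lt_trans Aw; exact: ler_norm.
rewrite /rejection_region /= normrM (gtr0_norm n0').
apply: lt_le_trans cn _; rewrite ler_pM2l//.
exact: emp_corr_lower g0 r1 Zw.
Qed.

(** * Asymptotics of the power bound *)

(** By [PhiN] the two tails are 1 - Phi (k (s - c)) and Phi (k (s + c)) with
s = sqrt n * r, and s - c <= s + c whatever the sign of s. *)
Lemma power_bound_le (R : realType) (alpha r c C : R) n : `|r| <= 1 -> 0 < c ->
  power_bound alpha r c C n <= 1 - 2 * C * Num.sqrt (ln n%:R / n%:R).
Proof.
move=> r1 c0; rewrite /power_bound /= lerD2r.
set k := 1 / (1 - r ^+ 2) * _; have k0 : 0 <= k.
  apply: mulr_ge0; last exact: sqrtr_ge0.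
  by rewrite mul1r invr_ge0 subr_ge0 -real_normK ?num_real// exprn_ile1.
set s := Num.sqrt _ * r.
rewrite (_ : k * (c - s) = - (k * (s - c))); last by ring.
rewrite PhiN -lerBrDr lerD2l lerN2.
by apply: le_Phi; rewrite ler_wpM2l//; lra.
Qed.

Lemma cvg_sqrt_nat (R : realType) : Num.sqrt (n%:R : R) @[n --> \oo] --> +oo.
Proof.
apply/cvgryPge => A; near=> n.
have An : A ^+ 2 <= n%:R by near: n; exact: nbhs_infty_ger.
have [A0|A0] := leP A 0; first by rewrite (le_trans A0)// sqrtr_ge0.
by rewrite -(ger0_norm (ltW A0)) -sqrtr_sqr ler_wsqrtr.
Unshelve. all: by end_near. Qed.

Lemma cvg_inv_sqrt_nat (R : realType) :
  (Num.sqrt (n%:R : R))^-1 @[n --> \oo] --> (0 : R).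
Proof.
apply/cvgrPdist_le => e e0; near=> n.
have h : e^-1 <= Num.sqrt (n%:R : R).
  by near: n; apply: (cvgryPge _).1; exact: cvg_sqrt_nat.
rewrite sub0r normrN ger0_norm ?invr_ge0 ?sqrtr_ge0// -[leRHS]invrK.
rewrite lef_pV2 ?posrE ?invr_gt0//.
by apply: lt_le_trans h; rewrite invr_gt0.
Unshelve. all: by end_near. Qed.

Lemma cvg_sqrt_ln_div (R : realType) :
  Num.sqrt (ln (n%:R : R) / n%:R) @[n --> \oo] --> (0 : R).
Proof.
rewrite -[X in _ --> X](@sqrtr0 R).
apply: (@cvg_comp _ _ _ (fun n : nat => ln (n%:R : R) / n%:R) Num.sqrt); last exact: sqrt_continuous.
apply: (@squeeze_cvgr _ _ _ _ (cst 0) (fun n : nat => 2 * (Num.sqrt (n%:R : R))^-1)).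
- near=> n.
  have n1 : (1 <= n)%N by near: n; exact: nbhs_infty_ge.
  have n0 : 0 < n%:R :> R by rewrite ltr0n.
  have s0 : 0 < Num.sqrt n%:R :> R by rewrite sqrtr_gt0.
  apply/andP; split; first by rewrite divr_ge0 ?ln_ge0 ?ler1n// ltW.
  have lnE : ln (n%:R : R) = 2 * ln (Num.sqrt n%:R).
    by rewrite -[in LHS](sqr_sqrtr (ltW n0)) lnXn// mulr_natl.
  have sn : (Num.sqrt n%:R)^-1 * n%:R = Num.sqrt n%:R :> R.
    by rewrite -[X in _ * X](sqr_sqrtr (ltW n0)) expr2 mulrA mulVf ?gt_eqF ?mul1r.
  by rewrite ler_pdivrMr// lnE -mulrA ler_pM2l// sn ltW// ln_sublinear.
- exact: cvg_cst.
- by rewrite -(mulr0 2); apply: cvgMr; exact: cvg_inv_sqrt_nat.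
Unshelve. all: by end_near. Qed.

Lemma cvg_affine_sqrt_nat (R : realType) (k r b : R) : 0 < k -> 0 < r ->
  k * (Num.sqrt (n%:R : R) * r + b) @[n --> \oo] --> +oo.
Proof.
move=> k0 r0; apply/cvgryPge => A; near=> n.
have h : (A / k - b) / r <= Num.sqrt (n%:R : R).
  by near: n; apply: (cvgryPge _).1; exact: cvg_sqrt_nat.
by rewrite mulrC -ler_pdivrMr// -lerBlDr -ler_pdivrMr.
Unshelve. all: by end_near. Qed.

(** The sum is symmetric in r, so r > 0 can be assumed: the first term tends to
1 and the second to 0. *)
Lemma cvg_Phi_pair (R : realType) (k c r : R) : 0 < k -> r != 0 ->
  Phi (k * (c - Num.sqrt n%:R * r)) + Phi (k * (c + Num.sqrt n%:R * r))
    @[n --> \oo] --> (1 : R).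
Proof.
move=> k0; wlog r0 : r / 0 < r => [hw r0|_].
  have [rp|rn|r00] := ltgtP r 0; last by rewrite r00 eqxx in r0.
    have := hw (- r); rewrite oppr_gt0 oppr_eq0 => /(_ rp r0).
    apply: cvg_trans; apply: near_eq_cvg; near=> n.
    by rewrite !mulrN opprK addrC.
  exact: hw.
rewrite [X in _ --> X](_ : 1 = (1 - 0) + 0); last by rewrite subr0 addr0.
have PhiE n : Phi (k * (c - Num.sqrt n%:R * r))
    = 1 - Phi (k * (Num.sqrt n%:R * r - c)).
  by rewrite -PhiN; congr Phi; ring.
under eq_fun do rewrite PhiE (addrC c).
apply: cvgD; first apply: cvgB; first exact: cvg_cst.
  apply: (@cvg_comp _ _ _ (fun n : nat => k * (Num.sqrt (n%:R : R) * r - c)) (@Phi R));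
    last exact: cvg_Phi_pinfty.
  exact: cvg_affine_sqrt_nat.
apply: (@cvg_comp _ _ _ (fun n : nat => k * (Num.sqrt (n%:R : R) * r + c)) (@Phi R));
    last exact: cvg_Phi_pinfty.
exact: cvg_affine_sqrt_nat.
Unshelve. all: by end_near. Qed.

Lemma cvg_power_bound (R : realType) (alpha r c C : R) : `|r| <= 1 -> r != 0 ->
  power_bound alpha r c C n @[n --> \oo] --> (1 : R).
Proof.
move=> r1 r0; rewrite -[X in _ --> X](subr0 1) -(mulr0 (2 * C)).
apply: cvgB; last by apply: cvgMr; exact: cvg_sqrt_ln_div.
set k := _ * _.
(* |r| = 1: both tails are taken at 0 *)
have [k0|k0] := eqVneq k 0.
  have P0 : Phi (0 : R) + Phi 0 = 1 by rewrite -{1}oppr0 PhiN subrK.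
  under eq_fun do rewrite /= k0 !mul0r P0.
  exact: cvg_cst.
apply: cvg_Phi_pair => //; rewrite lt_neqAle eq_sym k0/=.
apply: mulr_ge0; last exact: sqrtr_ge0.
by rewrite mul1r invr_ge0 subr_ge0 -real_normK ?num_real// exprn_ile1.
Qed.

Unset Implicit Arguments.

Theorem mainTheorem6 (R : realType) (alpha r : R)
    (alpha_lt1 : `|alpha| < 1) (r_le1 : `|r| <= 1) (r_neq0 : r != 0) :
  exists C13 : R, forall c_a : R, 0 < c_a ->
    [/\ \forall n \near \oo,
          forall (d : measure_display) (T : measurableType d)
            (P : probability T R) (xi eta : nat -> {RV P >-> R}),
            H_a r xi eta ->
            ((power_bound alpha r c_a C13 n)%:E
               <= P (rejection_region alpha c_a xi eta n))%E,
        power_bound alpha r c_a C13 n @[n --> \oo] --> (1 : R) &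
        forall (d : measure_display) (T : measurableType d)
          (P : probability T R) (xi eta : nat -> {RV P >-> R}),
          H_a r xi eta ->
          P (rejection_region alpha c_a xi eta n) @[n --> \oo] --> 1%E].
Proof.
have [C HC] := rejection_probability_lower alpha_lt1 r_le1 r_neq0.
exists 1 => c c0.
have cvgB := cvg_power_bound alpha c 1 r_le1 r_neq0.
have lower : \forall n \near \oo,
    forall (d : measure_display) (T : measurableType d)
      (P : probability T R) (xi eta : nat -> {RV P >-> R}), H_a r xi eta ->
    ((power_bound alpha r c 1 n)%:E <= P (rejection_region alpha c xi eta n))%E.
  near=> n => d T P xi eta Ha.
  have n1 : (0 < n)%N by near: n; exact: nbhs_infty_gt.
  have n0 : 0 < n%:R :> R by rewrite ltr0n.
  have s0 : 0 < Num.sqrt n%:R :> R by rewrite sqrtr_gt0.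
  have cn : c < Num.sqrt n%:R * (`|r| / 3).
    rewrite -ltr_pdivrMr ?divr_gt0 ?normr_gt0//.
    by near: n; apply: (cvgryPgt _).1; exact: cvg_sqrt_nat.
  apply: le_trans (HC c n n1 cn d T P xi eta Ha); rewrite lee_fin.
  apply: le_trans (power_bound_le _ _ _ _ _) _ => //.
  rewrite lerD2l lerN2 mulr1 sqrtrM; last by rewrite ln_ge0// ler1n.
  rewrite sqrtrV ?(ltW n0)// mulrA ler_wpM2r ?invr_ge0 ?(ltW s0)//.
  (* from here on sqrt (ln n) dominates the constant C *)
  have Cn : expR (C ^+ 2) <= n%:R by near: n; exact: nbhs_infty_ger.
  apply: le_trans (ler_norm C) _; rewrite -sqrtr_sqr.
  apply: (@le_trans _ _ (Num.sqrt (ln n%:R))).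
    by rewrite ler_wsqrtr// -ler_expR lnK.
  by rewrite ler_peMl ?sqrtr_ge0// ler1n.
split=> // d T P xi eta Ha.
have sandwich : \forall n \near \oo, ((power_bound alpha r c 1 n)%:E
    <= P (rejection_region alpha c xi eta n) <= cst 1%E n)%E.
  near=> n; apply/andP; split; last first.
    by apply: probability_le1; exact: measurable_rejection_region.
  by move: d T P xi eta Ha; near: n.
apply: (squeeze_cvge sandwich); last exact: cvg_cst.
by apply/cvg_EFin => //; near=> n.
Unshelve. all: by end_near. Qed.
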